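(* Let $(S_n)_{n\in\mathbb Z}$ be the double-sided random walk on $\mathbb Z$ with $S_0=0$ and i.i.d. jumps $S_n-S_{n-1}$ uniform in $\{\pm1\}$, and let $\Psi:=\{(n,S_n):n\in\mathbb Z\}\subseteq\mathbb R^2$ be its graph, rooted at $0$ and equipped with the metric $$d((x,y),(x',y')):=\max\{\sqrt{|x-x'|},\,|y-y'|\}.$$ Then $\mathrm{udim}_M(\Psi)=\mathrm{udim}_H(\Psi)=2$.
   Context: $\Psi$ is a point-stationary point process in $\mathbb R^2$, i.e. a random locally finite subset with $0\in\Psi$ a.s. such that $\mathbb E[\sum_{x\in\Psi}g(\Psi,0,x)]=\mathbb E[\sum_{x\in\Psi}g(\Psi,x,0)]$ for all measurable $g(\varphi,x,y)\ge0$ ($\varphi$ discrete, $x,y\in\varphi$) invariant under joint translations. Equivariant processes. An equivariant process with values in a complete separable metric space $\Xi$ on $\Psi$ assigns to (almost) every realization $\varphi$ a random marking $\boldsymbol Z_\varphi\in\Xi^{\varphi\times\varphi}$ (extra randomness allowed; the mark of a point $x$ is that of $(x,x)$), depending measurably on $\varphi$, such that for every translation $\rho$, $\boldsymbol Z_\varphi\circ\rho^{-1}$ has the same distribution as $\boldsymbol Z_{\rho(\varphi)}$. An equivariant subset is the set of points with mark 1 in a $\{0,1\}$-valued equivariant process; its intensity is $\mathbb P[0\in\boldsymbol S_\Psi]$. Dimensions (all balls being with respect to $d$). $N_r(v)$ is the closed ball in $\Psi$ of radius $r\ge1$ and $N_0(v):=\emptyset$. An equivariant $r$-covering is an equivariant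 subset $\boldsymbol R$ such that the balls $N_r(v)$, $v\in\boldsymbol R_\Psi$, cover $\Psi$ a.s.; $\lambda_r$ is the infimum of their intensities; $\mathrm{udim}_M(\Psi):=\lim_{r\to\infty}\frac{-\log\lambda_r}{\log r}$ when the limit exists (the statement includes existence). An equivariant covering is an equivariant process $\boldsymbol R$ with values in $\{0\}\cup[1,\infty)$ on points such that the balls $N_{\boldsymbol R(v)}(v)$ cover $\Psi$ a.s.; $\mathcal H^\alpha_1(\Psi):=\inf_{\boldsymbol R}\mathbb E[\boldsymbol R(0)^\alpha]$ over all of them ($0^0:=0$), and $\mathrm{udim}_H(\Psi):=\sup\{\alpha\ge0:\mathcal H^\alpha_1(\Psi)=0\}$, $\sup\emptyset:=0$. *)

(* Defs.v *)
From HB Require Import structures.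
From mathcomp Require Import all_boot all_order all_algebra.
From mathcomp Require Import all_classical all_reals all_analysis.
From mathcomp Require Import measurable_realfun.

Set Implicit Arguments.
Unset Strict Implicit.
Unset Printing Implicit Defensive.

Import Order.TTheory GRing.Theory Num.Theory.
Import numFieldNormedType.Exports.

Local Open Scope classical_set_scope.
Local Open Scope card_scope.
Local Open Scope ring_scope.

Section Configurations.
Context {R : realType}.
Implicit Types (phi : set (R * R)) (t x : R * R).

(* Events counting the points in a Borel set.  On locally finite sets they
   generate the usual sigma-algebra of point configurations. *)
Definition count_events : set (set (set (R * R))) :=
  [set E | exists (B : set (R * R)) (n : nat),
     measurable B /\ E = [set phi | phi `&` B #= `I_n]].

Definition conf := g_sigma_algebraType count_events.

Definition locally_finite phi :=
  forall M : R, finite_set (phi `&` [set x | `|x| <= M]).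

Definition translate t phi : set (R * R) := [set x | phi (x - t)].

Definition untranslate t phi (x : translate t phi) : phi :=
  exist _ (val x - t) (valP x).

End Configurations.
Arguments conf : clear implicits.

(* The mark space X stands for a complete separable metric space with its
   Borel sigma-algebra; only {0, 1} and {0} U [1, +oo[ are used below. *)
Section Markings.
Context {R : realType} {dX : measure_display} (X : measurableType dX).
Implicit Types (phi : set (R * R)) (t x : R * R).

Definition marking phi := (phi * phi)%type -> X.

Definition cylinders phi : set (set (marking phi)) :=
  [set C | exists (p : phi * phi) (B : set X),
     measurable B /\ C = (fun z : marking phi => z p) @^-1` B].

(* The law of a random element of X^(phi x phi): a measure on the product
   sigma-algebra. *)
Definition marking_law phi :=
  probability (g_sigma_algebraType (@cylinders phi)) R.

Definition translate_marking t phi (z : marking phi) :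
    marking (translate t phi) :=
  fun p => z (untranslate p.1, untranslate p.2).

(* The mark of a point x is that of (x, x); off phi it takes the irrelevant
   value point. *)
Definition mark phi (z : marking phi) x : X := valL (fun u : phi => z (u, u)) x.

(* Marked configurations are identified with the point configurations
   {(x, y, z(x, y))} in R^2 x R^2 x X, and measured by counting. *)
Definition marked_conf := {phi : set (R * R) & marking phi}.

Definition marked_points (m : marked_conf) : set ((R * R) * (R * R) * X) :=
  range (fun p : projT1 m * projT1 m => (val p.1, val p.2, projT2 m p)).

Definition marked_count_events : set (set marked_conf) :=
  [set E | exists (B : set ((R * R) * (R * R) * X)) (n : nat),
     measurable B /\ E = [set m | marked_points m `&` B #= `I_n]].

Section Equivariance.
Context {dO : measure_display} {O : measurableType dO} (P : probability O R).
Context (Psi : O -> set (R * R)).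

(* Z phi is the law of the random marking of phi.  It is only constrained on a
   set D of configurations that contains almost every realization of Psi and
   is stable under moving any of its points to the origin; outside D the value
   of Z is junk, so translation-equivariance is asked where both sides are
   meaningful. *)
Record equivariant_on (D : set (conf R))
    (Z : forall phi : set (R * R), marking_law phi) : Prop := EquivariantOn {
  equivariant_measurable : measurable D;
  equivariant_ae : {ae P, forall w, D (Psi w)};
  equivariant_locally_finite : forall phi, D phi -> locally_finite phi;
  equivariant_reroot :
    forall phi x, D phi -> phi x -> D (translate (- x) phi);
  equivariant_measurable_fun : forall E, <<s marked_count_events >> E ->
    measurable_fun D
      (fun phi : conf R => Z phi [set z | E (existT _ phi z)]);
  equivariant_translate : forall phi t, D phi -> D (translate t phi) ->
    forall A : set (g_sigma_algebraType (@cylinders (translate t phi))),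
      measurable A ->
      Z (translate t phi) A = Z phi (@translate_marking t phi @^-1` A)
}.

Definition equivariant_process
    (Z : forall phi : set (R * R), marking_law phi) : Prop :=
  exists D, equivariant_on D Z.

End Equivariance.
End Markings.
Arguments marking {R dX} X phi.
Arguments marking_law {R dX} X phi.

Definition radius (R : realType) := {r : R | (r == 0) || (1 <= r)}.

Section Radius.
Context (R : realType).

HB.instance Definition _ := Choice.on (radius R).

Fact radius0_subproof : ((0 : R) == 0) || (1 <= (0 : R)).
Proof. by rewrite eqxx. Qed.

HB.instance Definition _ :=
  isPointed.Build (radius R) (exist _ 0 radius0_subproof).

Definition radius_val (r : radius R) : R := val r.

(* {0} U [1, +oo[ with the trace of the Borel sigma-algebra *)
Definition radiusM := g_sigma_algebra_preimageType radius_val.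

End Radius.

Section Dimensions.
Context {R : realType} {dO : measure_display} {O : measurableType dO}.
Context (P : probability O R) (Psi : O -> set (R * R)).
Context (dist : R * R -> R * R -> R).
Implicit Types (phi : set (R * R)) (x v : R * R).

Definition cball phi (r : R) v : set (R * R) :=
  if r == 0 then set0 else [set x | phi x /\ dist v x <= r].

Definition marked_subset phi (z : marking bool phi) : set (R * R) :=
  [set x | phi x /\ mark z x = true].

Definition intensity (Z : forall phi : set (R * R), marking_law bool phi) :
    \bar R :=
  (\int[P]_w Z (Psi w) [set z | marked_subset z 0%R])%E.

Definition equivariant_rcovering (r : R)
    (Z : forall phi : set (R * R), marking_law bool phi) : Prop :=
  equivariant_process P Psi Z /\
  {ae P, forall w, {ae Z (Psi w), forall z,
    Psi w `<=` \bigcup_(v in marked_subset z) cball (Psi w) r v}}.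

Definition lambda (r : R) : \bar R :=
  ereal_inf [set intensity Z | Z in equivariant_rcovering r].

Definition is_udimM (l : \bar R) : Prop :=
  (- lne (lambda r) / (ln r)%:E)%E @[r --> +oo%R] --> l.

Definition mark_radius phi (z : marking (radiusM R) phi) x : R :=
  radius_val (mark z x).

Definition equivariant_covering
    (Z : forall phi : set (R * R), marking_law (radiusM R) phi) : Prop :=
  equivariant_process P Psi Z /\
  {ae P, forall w, {ae Z (Psi w), forall z,
    Psi w `<=` \bigcup_(v in Psi w) cball (Psi w) (mark_radius z v) v}}.

(* r `^ a with the convention 0 `^ 0 = 0 *)
Definition pow0 (r a : R) : R := if r == 0 then 0 else r `^ a.

Definition hcontent1 (a : R) : \bar R :=
  ereal_inf
    [set (\int[P]_w \int[Z (Psi w)]_z (pow0 (mark_radius z 0%R) a)%:E)%E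
    | Z in equivariant_covering].

(* Adding 0 to the set only implements sup set0 := 0. *)
Definition udimH : \bar R :=
  ereal_sup (0%E |` [set a%:E | a in [set a : R | 0 <= a /\ hcontent1 a = 0%E]]).

End Dimensions.

Section RandomWalk.
Context {R : realType} {dO : measure_display} {O : measurableType dO}.
Context (P : probability O R).

(* int carries the discrete sigma-algebra. *)
Definition mutually_independent (I : choiceType) (Y : I -> O -> int) : Prop :=
  forall (s : seq I) (A : I -> set int), uniq s ->
    P (\bigcap_(i in [set` s]) (Y i @^-1` A i)) =
    (\prod_(i <- s) P (Y i @^-1` A i))%E.

Definition jump (S : int -> O -> int) (n : int) (w : O) : int :=
  S n w - S (n - 1) w.

Record simple_random_walk (S : int -> O -> int) : Prop := SimpleRandomWalk {
  walk0 : forall w, S 0 w = 0;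
  walk_measurable : forall n (A : set int), measurable (S n @^-1` A);
  walk_jump1 : forall n, P [set w | jump S n w = 1] = (2^-1)%:E;
  walk_jumpN1 : forall n, P [set w | jump S n w = -1] = (2^-1)%:E;
  walk_independent : mutually_independent (jump S)
}.

Definition walk_graph (S : int -> O -> int) (w : O) : set (R * R) :=
  range (fun n : int => (n%:~R, (S n w)%:~R)).

Definition parabolic_dist (p q : R * R) : R :=
  Num.max (Num.sqrt `|p.1 - q.1|) `|p.2 - q.2|.

End RandomWalk.

(* Main.v *)
(* The walk stays within distance r of its starting point for about r^2 steps,
   so intervals of about r^2 consecutive times are balls of radius about r.

   Upper bounds.  Cut the time line into blocks of length L = m + 1 with a
   uniform random phase, and select the last point of every block together with
   every point whose height differs by more than r from that of the last point of
   its block.  If m <= r^2 the balls of radius r around the selected points cover,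
   and the intensity is at most 1/L + max_{j < L} P(|S_j| > r).  Flipping the last
   jump preserves the law of the walk, which gives
   E[exp(x S_k)] <= cosh(x)^k <= exp(2 k x^2), hence a Gaussian tail bound; with
   r = e^u, L ~ r^2 / u^2 and x = 2 u / r the intensity is O(u^2 e^(-2u)).  The
   radius r on the selected points then also gives H^al_1 = 0 for al < 2.

   Lower bounds.  The origin is covered by a point at some time n with
   |n| <= R^2, where R is the radius at that point.  By stationarity of the
   increments the expected number of such points is at most the expected number
   of times n with |n| <= R(0)^2 and R(0) >= 1, hence 1 <= 4 E[R(0)^2] for every
   equivariant covering R. *)

Require Import Defs.
From HB Require Import structures.
From mathcomp Require Import finmap all_boot all_order all_algebra.
From mathcomp Require Import all_classical all_reals all_analysis.
From mathcomp Require Import measurable_realfun zify ring lra.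

Set Implicit Arguments.
Unset Strict Implicit.
Unset Printing Implicit Defensive.

Import Order.TTheory GRing.Theory Num.Theory.
Import numFieldNormedType.Exports.

Local Open Scope classical_set_scope.
Local Open Scope card_scope.
Local Open Scope ring_scope.

(** * Measurability of discrete observables *)

HB.instance Definition _ := isPointed.Build int 0.

Section MeasureGeneralities.
Context {d : measure_display} {T : measurableType d} {R : realType}.

(* Unlike [ge0_le_integral], no measurability is needed: both integrals are
   suprema over the simple functions below the integrand. *)
Lemma ge0_le_integral_nomeas (mu : {measure set T -> \bar R})
    (f g : T -> \bar R) :
  (forall x, 0 <= f x)%E -> (forall x, f x <= g x)%E ->
  (\int[mu]_x f x <= \int[mu]_x g x)%E.
Proof.
move=> f0 fg; have g0 x : (0 <= g x)%E := le_trans (f0 x) (fg x).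
rewrite !ge0_integralTE//; apply: ereal_sup_le => _ [h /= hf <-].
by exists h => // x; exact: le_trans (hf x) (fg x).
Qed.

Section DiscreteValued.
Variable D : set T.
Hypothesis mD : measurable D.

(** For countable [C] this is measurability of [f] on [D] into the discrete sigma-algebra, reduced
    to fibres. It is relative to [D] because path heights can only be read off configurations that
    are graphs. *)
Definition discrete_on (C : Type) (f : T -> C) :=
  forall c, measurable (D `&` f @^-1` [set c]).

Lemma discrete_on_preimage (C : countType) (f : T -> C) (Q : set C) :
  discrete_on f -> measurable (D `&` f @^-1` Q).
Proof.
move=> mf.
have -> : D `&` f @^-1` Q =
    \bigcup_c (if `[< Q c >] then D `&` f @^-1` [set c] else set0).
  apply/seteqP; split=> [x [Dx Qfx]|x [c _]].
    by exists (f x) => //; case: asboolP.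
  by case: asboolP => // Qc [Dx fx]; split=> //=; rewrite fx.
apply: countable_bigcupT_measurable => [|c]; first exact: countableP.
by case: ifP.
Qed.

Lemma discrete_on_comp (C : countType) (C' : Type) (f : T -> C) (g : C -> C') :
  discrete_on f -> discrete_on (g \o f).
Proof. by move=> mf c; rewrite comp_preimage; exact: discrete_on_preimage. Qed.

Lemma discrete_on_pair (C C' : Type) (f : T -> C) (g : T -> C') :
  discrete_on f -> discrete_on g -> discrete_on (fun x => (f x, g x)).
Proof.
move=> mf mg [c c'].
have -> : D `&` (fun x => (f x, g x)) @^-1` [set (c, c')] =
    (D `&` f @^-1` [set c]) `&` (D `&` g @^-1` [set c']).
  apply/seteqP; split=> [x [Dx [<- <-]]//|x [[Dx <-] [_ <-]]//].
exact: measurableI.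
Qed.

Lemma measurable_fun_discrete (d' : measure_display) (U : measurableType d')
    (C : countType) (f : T -> C) (g : C -> U) :
  discrete_on f -> measurable_fun D (g \o f).
Proof.
by move=> mf _ Y mY; rewrite comp_preimage; exact: discrete_on_preimage.
Qed.

(* The event is a countable union, over the finite sets F of indices of size n,
   of the events that exactly the indices of F occur. *)
Lemma measurable_count (I : countType) (A : I -> set T) (n : nat) :
  (forall i, measurable (D `&` A i)) ->
  measurable (D `&` [set x | [set i | A i x] #= `I_n]).
Proof.
move=> mA.
pose B (F : {fset I}) i := if i \in F then D `&` A i else D `\` (D `&` A i).
have -> : D `&` [set x | [set i | A i x] #= `I_n] =
    D `&` \bigcup_(F in [set: {fset I}])
      (* [unpickle] turns the intersection over the countable type [I] into one over [nat]; numbers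
         that code no index impose only [D]. *)
      (if (#|` F| == n)%N then
         \bigcap_(k in [set: nat]) (if unpickle k is Some i then B F i else D)
       else set0).
  apply/seteqP; split=> [x [Dx Ax]|x [Dx [F _]]].
    split=> //.
    have fA : finite_set [set i | A i x] by exists n.
    have /finite_fsetP[F FE] := fA.
    have /eqP cF : #|` F| = n by apply/card_eq_fsetP; rewrite -FE.
    exists F => //; rewrite cF.
    move=> k _; case: unpickle => // i; rewrite /B.
    case: ifPn => [iF|/negP iF].
      by split=> //; suff : [set` F] i by rewrite -FE.
    split=> // -[_ Ai]; apply: iF; suff : [set i | A i x] i by rewrite FE.
    by [].
  case: eqP => // /card_eq_fsetP cF H; split=> //=.
  suff -> : [set i | A i x] = [set` F] by [].
  have HB i : B F i x by have := H (pickle i) Logic.I; rewrite pickleK.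
  apply/seteqP; split=> i /=; have := HB i; rewrite /B; case: ifPn => //.
    by move=> _ [_ nA] Ai; exfalso; exact: nA.
  by move=> _ [].
apply: measurableI => //; apply: countable_bigcupT_measurable => [|F].
  exact: countableP.
case: ifP => // _; apply: bigcap_measurable => [|k _]; first by exists 0%N.
case: unpickle => // i; rewrite /B; case: ifP => // _.
exact: measurableD.
Qed.

End DiscreteValued.
End MeasureGeneralities.

(** * The law of a sequence of fair jumps *)

(** The two-sided path through 0 whose jump from time n - 1 to time n is [t n]. Time -(k + 1) is
    reached by undoing the jumps at 0, -1, ..., -k. *)
Definition height (t : int -> int) (n : int) : int :=
  match n with
  | Posz k => \sum_(i < k) t i.+1
  | Negz k => - \sum_(i < k.+1) t (- i%:Z)
  end.
Arguments height : simpl never.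

Section Heights.
Implicit Types (t : int -> int) (n : int).

Lemma height0 t : height t 0 = 0.
Proof. exact: big_ord0. Qed.

Lemma height_step t n : height t (n + 1) = height t n + t (n + 1).
Proof.
case: n => k; first by rewrite [Posz k + 1]addrC -intS /height big_ord_recr/= intS addrC.
rewrite NegzE; case: k => [|k].
  by rewrite addNr height0 /height /= big_ord_recl big_ord0 addr0 oppr0 addNr.
rewrite (_ : - (k.+2 : int) + 1 = Negz k); last by lia.
rewrite -NegzE /height [in RHS]big_ord_recr/= opprD -addrA.
by rewrite (_ : Negz k = - k.+1%:Z) ?addNr ?addr0// NegzE.
Qed.

Lemma height_unique t (f : int -> int) :
  f 0 = 0 -> (forall n, f n - f (n - 1) = t n) -> f = height t.
Proof.
move=> f0 ft; have fS n : f (n + 1) = f n + t (n + 1).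
  by rewrite -ft addrK addrCA subrr addr0.
apply/funext; elim/int_rect => [|n IH|n IH]; first by rewrite f0 height0.
  by rewrite intS addrC fS IH height_step.
have /eqP := fS (- n.+1%:Z); have := height_step t (- n.+1%:Z).
rewrite (_ : - n.+1%:Z + 1 = - n%:Z); last by lia.
by rewrite IH => -> /eqP /addIr.
Qed.

(** Both sides vanish at 0 and have the same jumps. Shifting the jumps thus re-roots the path at
    time [n]. *)
Lemma height_shift t n m :
  height (fun i => t (i + n)) m = height t (m + n) - height t n.
Proof.
rewrite -(@height_unique _ (fun m => height t (m + n) - height t n))//.
  by rewrite add0r subrr.
move=> i /=; have := height_step t (i - 1 + n).
rewrite (_ : i - 1 + n + 1 = i + n); last by lia.
by move=> ->; lia.
Qed.

End Heights.

Section JumpLaw.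
Context {R : realType}.

(** Cylinder events on finitely many coordinates. They form a pi-system, so they determine a law on
    paths. *)
Definition path_events : set (set (int -> int)) :=
  [set E | exists (s : seq int) (A : int -> set int),
     E = \bigcap_(i in [set` s]) [set t : int -> int | A i (t i)]].

Definition path := g_sigma_algebraType path_events.

Lemma measurable_coordinate (i : int) (A : set int) :
  measurable ([set t | A (t i)] : set path).
Proof.
apply: sub_sigma_algebra; exists [:: i], (fun=> A).
apply/seteqP; split=> [t At j /=|t H]; last by apply: (H i); rewrite /= inE.
by rewrite inE => /eqP ->.
Qed.

Lemma setI_closed_path_events : setI_closed path_events.
Proof.
move=> _ _ [s [A ->]] [s' [A' ->]].
(* The constraints are guarded by membership: an index in both lists carries both, an index in one
   list only its own. *)
exists (s ++ s'), (fun i => [set k | (i \in s -> A i k) /\ (i \in s' -> A' i k)]).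
apply/seteqP; split=> [t [H H'] i _ /=|t H]; first by split=> ?; [exact: H|exact: H'].
by split=> i /= si; [apply: (H i _).1|apply: (H i _).2] => //=;
  rewrite mem_cat si ?orbT.
Qed.

Lemma discrete_height (n : int) :
  discrete_on [set: path] (fun t : path => height t n).
Proof.
have dt i : discrete_on [set: path] (fun t : path => (t : int -> int) i).
  by move=> c; rewrite setTI; exact: (measurable_coordinate i [set c]).
elim/int_rect: n => [|n IH|n IH].
- move=> c; rewrite setTI; have [->|c0] := eqVneq c 0.
    rewrite (_ : _ @^-1` _ = setT)//; apply/seteqP; split=> // t _ /=.
    exact: height0.
  rewrite (_ : _ @^-1` _ = set0)//; apply/seteqP; split=> // t /=.
  by rewrite height0 => /eqP; rewrite eq_sym (negbTE c0).
- rewrite (_ : (fun t : path => height t n.+1) = (fun p : int * int => p.1 + p.2)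
      \o (fun t : path => (height t n, (t : int -> int) (n%:Z + 1)))); last first.
    by apply/funext => t /=; rewrite -height_step intS addrC.
  by apply: discrete_on_comp => //; exact: discrete_on_pair.
- rewrite (_ : (fun t : path => height t (- n.+1%:Z)) =
     (fun p : int * int => p.1 - p.2)
      \o (fun t : path => (height t (- n%:Z), (t : int -> int) (- n%:Z)))); last first.
    apply/funext => t /=; have := height_step t (- n.+1%:Z).
    by rewrite (_ : - n.+1%:Z + 1 = - n%:Z) => [->|]; [rewrite addrK|lia].
  by apply: discrete_on_comp => //; exact: discrete_on_pair.
Qed.

Context {dO : measure_display} {O : measurableType dO} (P : probability O R).
Implicit Types J : int -> O -> int.

Definition path_of J (w : O) : path := fun i => J i w.

(** What the law of the walk requires of its jumps, separated from the walk so that shifted and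
    flipped jump sequences qualify as well. *)
Record fair_jumps J : Prop := FairJumps {
  fair_measurable : forall n (A : set int), measurable (J n @^-1` A);
  fair_jump1 : forall n, P [set w | J n w = 1] = (2^-1)%:E;
  fair_jumpN1 : forall n, P [set w | J n w = -1] = (2^-1)%:E;
  fair_independent : mutually_independent P J
}.

Lemma measurable_path_of J : (forall n (A : set int), measurable (J n @^-1` A)) ->
  measurable_fun setT (path_of J).
Proof.
move=> mJ; apply: (@measurability _ _ O path setT (path_of J) path_events) => //.
move=> _ [_ [s [A ->]] <-]; rewrite setTI.
rewrite (_ : _ @^-1` _ = \bigcap_(i in [set` s]) (J i @^-1` A i))//.
rewrite bigcap_seq; elim: s => [|i s IH]; first by rewrite big_nil.
by rewrite big_cons; apply: measurableI.
Qed.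

Lemma fair_jump_ae J n : fair_jumps J ->
  P [set w | J n w != 1 /\ J n w != -1] = 0%E.
Proof.
move=> fJ; have mJ A := fair_measurable fJ n A.
have p1 : P (J n @^-1` [set 1]) = (2^-1)%:E := fair_jump1 fJ n.
have pN1 : P (J n @^-1` [set -1]) = (2^-1)%:E := fair_jumpN1 fJ n.
rewrite (_ : [set w | _] = ~` (J n @^-1` [set 1] `|` J n @^-1` [set -1])).
  rewrite probability_setC; last exact: measurableU.
  have -> : P (J n @^-1` [set 1] `|` J n @^-1` [set -1]) =
      (P (J n @^-1` [set 1%R]) + P (J n @^-1` [set (-1)%R]))%E.
    by apply: measureU => //; apply/seteqP; split=> // w [/= ->].
  by rewrite p1 pN1 -!EFinD; congr EFin; lra.
apply/seteqP; split=> [w [/eqP a /eqP b] []//|w /= H].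
by split; apply/eqP => ?; apply: H; [left|right].
Qed.

(** Values other than 1 and -1 form a null event, so only the membership of these two in [A] counts.
    All fair jumps therefore share their marginals. *)
Lemma fair_marginal J n (A : set int) : fair_jumps J ->
  P (J n @^-1` A) = ((`[< A 1 >] + `[< A (-1) >])%:R / 2)%:E.
Proof.
move=> fJ; have mJ B := fair_measurable fJ n B.
have p1 : P (J n @^-1` [set 1]) = (2^-1)%:E := fair_jump1 fJ n.
have pN1 : P (J n @^-1` [set -1]) = (2^-1)%:E := fair_jumpN1 fJ n.
have E a : P (J n @^-1` (A `&` [set a])) =
    (if `[< A a >] then P (J n @^-1` [set a]) else 0)%E.
  case: asboolP => Aa; last first.
    by rewrite (_ : _ @^-1` _ = set0) ?measure0//;
      apply/seteqP; split=> // w [/= + Jw]; rewrite Jw.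
  congr (P _); apply/seteqP; split=> [w []//|w /= Jw].
  by split=> //=; rewrite Jw.
pose N := J n @^-1` (A `&` [set k | k != 1 /\ k != -1]).
have N0 : P N = 0%E.
  apply/eqP; rewrite eq_le measure_ge0 andbT -(fair_jump_ae n fJ).
  apply: le_measure; rewrite ?inE; [exact: mJ| |by move=> w []].
  exact: (mJ [set k | k != 1 /\ k != -1]).
rewrite (_ : J n @^-1` A = (J n @^-1` (A `&` [set 1]) `|`
   J n @^-1` (A `&` [set -1])) `|` N); last first.
  apply/seteqP; split=> [w Aw|w [[[]|[]]|[]]//].
  have [J1|J1] := eqVneq (J n w) 1; first by left; left.
  have [JN|JN] := eqVneq (J n w) (-1); first by left; right.
  by right.
have PU B C : measurable B -> measurable C -> B `&` C = set0 ->
  P (B `|` C) = (P B + P C)%E by exact: measureU.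
rewrite PU; [|exact: measurableU|exact: mJ|]; last first.
  by apply/seteqP; split=> // w [[[_ /= e]|[_ /= e]] [_ /= []]]; rewrite e.
rewrite PU; [|exact: mJ|exact: mJ|]; last first.
  by apply/seteqP; split=> // w [[_ /= e] [_ /=]]; rewrite e.
rewrite N0 adde0 !E p1 pN1.
by case: `[< _ >]; case: `[< _ >];
  rewrite ?adde0 ?add0e -?EFinD/= ?addn0 ?add0n; congr EFin; lra.
Qed.

(** By independence both laws give a cylinder the same product of marginals, and cylinders are a
    generating pi-system. *)
Lemma fair_jumps_law J J' (E : set path) : fair_jumps J -> fair_jumps J' ->
  measurable E -> P (path_of J @^-1` E) = P (path_of J' @^-1` E).
Proof.
move=> fJ fJ' mE.
have mJ := measurable_path_of (fair_measurable fJ).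
have mJ' := measurable_path_of (fair_measurable fJ').
pose X : {mfun O >-> path} := HB.pack (path_of J) (isMeasurableFun.Build _ _ _ _ _ mJ).
pose X' : {mfun O >-> path} := HB.pack (path_of J') (isMeasurableFun.Build _ _ _ _ _ mJ').
have pT : path_events setT.
  by exists [::], (fun=> setT); apply/seteqP; split=> // t _ i.
apply: (@measure_unique _ R path path_events (fun=> setT) erefl
  setI_closed_path_events (fun=> pT) _ (distribution P X) (distribution P X') _ _ E mE).
- by apply/seteqP; split=> // t _; exists 0%N.
- move=> _ [s [A ->]]; rewrite /distribution /pushforward/=.
  (* Independence is stated for duplicate-free lists, hence [undup]. *)
  have bigE K : fair_jumps K ->
    P (path_of K @^-1` (\bigcap_(i in [set` s]) [set t : path | A i ((t : int -> int) i)])) =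
    (\prod_(i <- undup s) ((`[< A i 1 >] + `[< A i (-1) >])%:R / 2)%:E)%E.
    move=> fK; rewrite (_ : _ @^-1` _ = \bigcap_(i in [set` undup s]) (K i @^-1` A i)).
      rewrite (fair_independent fK) ?undup_uniq//; apply: eq_bigr => i _.
      exact: fair_marginal.
    apply/seteqP; split=> w H i /=; first by rewrite mem_undup => /H.
    by move=> si; apply: H; rewrite /= mem_undup.
  exact: etrans (bigE J fJ) (esym (bigE J' fJ')).
- by move=> _; apply: le_lt_trans (probability_le1 _ measurableT) (ltry 1).
Qed.

Lemma fair_jumps_integral J J' (f : path -> \bar R) :
  fair_jumps J -> fair_jumps J' ->
  measurable_fun setT f -> (forall t, 0 <= f t)%E ->
  (\int[P]_w f (path_of J w) = \int[P]_w f (path_of J' w))%E.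
Proof.
move=> fJ fJ' mf f0.
have mJ := measurable_path_of (fair_measurable fJ).
have mJ' := measurable_path_of (fair_measurable fJ').
pose X : {mfun O >-> path} := HB.pack (path_of J) (isMeasurableFun.Build _ _ _ _ _ mJ).
pose X' : {mfun O >-> path} := HB.pack (path_of J') (isMeasurableFun.Build _ _ _ _ _ mJ').
rewrite -[LHS](ge0_integral_distribution X mf f0).
rewrite -[RHS](ge0_integral_distribution X' mf f0).
apply: eq_measure_integral => A mA _.
exact: fair_jumps_law.
Qed.

Lemma fair_jumps_shift J n : fair_jumps J -> fair_jumps (fun i => J (i + n)).
Proof.
move=> fJ; split=> [i A|i|i|s A us]; [exact: (fair_measurable fJ)|
  exact: (fair_jump1 fJ)|exact: (fair_jumpN1 fJ)|].
have := fair_independent fJ (s := [seq i + n | i <- s]) (fun i => A (i - n)).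
rewrite map_inj_uniq; last exact: addIr.
move=> /(_ us); rewrite big_map => H.
rewrite (eq_bigr (fun i => P (J (i + n) @^-1` A (i + n - n)))); last first.
  by move=> i _; rewrite addrK.
rewrite -H; congr (P _); apply/seteqP; split=> w Hw i /=.
  by move=> /mapP[j js ->]; rewrite addrK; exact: Hw.
by move=> si; have := Hw (i + n); rewrite /= addrK; apply; exact: map_f.
Qed.

Lemma fair_jumps_flip J n : fair_jumps J ->
  fair_jumps (fun i w => if i == n then - J i w else J i w).
Proof.
move=> fJ.
pose B (A : set int) i : set int := if i == n then [set k | A (- k)] else A.
have E i A : (fun w => if i == n then - J i w else J i w) @^-1` A =
    J i @^-1` B A i by rewrite /B; case: eqP.
split=> [i A|i|i|s A us].
- by rewrite E; exact: (fair_measurable fJ).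
- have [in_|in_] := eqVneq i n; last exact: (fair_jump1 fJ).
  rewrite -(fair_jumpN1 fJ i); congr (P _); apply/seteqP.
  by split=> w /=; lia.
- have [in_|in_] := eqVneq i n; last exact: (fair_jumpN1 fJ).
  rewrite -(fair_jump1 fJ i); congr (P _); apply/seteqP.
  by split=> w /=; lia.
- have := fair_independent fJ (s := s) (fun i => B (A i) i) us.
  rewrite (eq_bigr (fun i => P ((fun w => if i == n then - J i w else J i w) @^-1` A i))).
    by move=> <-; congr (P _); apply: eq_bigcapr => i _; rewrite E.
  by move=> i _; rewrite E.
Qed.

End JumpLaw.

(** * Graphs of integer paths as configurations *)

Section IntegerGraphs.
Context {R : realType}.
Implicit Types (h : int -> int) (phi : set (R * R)) (x t : R * R).

Definition graph_point h (n : int) : R * R := (n%:~R, (h n)%:~R).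
Definition graph h : set (R * R) := range (graph_point h).

Lemma graphE h (n a : int) : graph h (n%:~R, a%:~R) <-> h n = a.
Proof.
split=> [[m _ [/eqP + /eqP]]|<-]; last by exists n.
by rewrite !eqr_int => /eqP -> /eqP.
Qed.

Lemma graph_point_inj h : injective (graph_point h).
Proof. by move=> m n [/eqP + _]; rewrite eqr_int => /eqP. Qed.

Lemma card_graphI h (B : set (R * R)) (n : nat) :
  (graph h `&` B #= `I_n) = ([set i | B (graph_point h i)] #= `I_n).
Proof.
have -> : graph h `&` B = graph_point h @` [set i | B (graph_point h i)].
  by apply/seteqP; split=> [_ [[i _ <-] Bi]|_ [i Bi <-]]; [exists i|split=> //; exists i].
by apply/card_eql/inj_card_eq => i j _ _; exact: graph_point_inj.
Qed.

Lemma measurable_count_event (B : set (R * R)) (n : nat) : measurable B ->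
  measurable ([set phi | phi `&` B #= `I_n] : set (conf R)).
Proof. by move=> mB; apply: sub_sigma_algebra; exists B, n. Qed.

Lemma measurable_point x : measurable [set x].
Proof.
case: x => a b; rewrite (_ : [set (a, b)] = [set a] `*` [set b]).
  exact: measurableX.
by apply/seteqP; split=> [_ ->//|[c e] [/= -> ->]].
Qed.

(** Counting the points of the graph in a Borel set is counting the times whose point lies in it: a
    countable family of events, each depending on one height. *)
Lemma measurable_graph d (Y : measurableType d) (D : set Y)
    (h : Y -> int -> int) : measurable D ->
  (forall n, discrete_on D (h^~ n)) ->
  measurable_fun D (fun y => graph (h y) : conf R).
Proof.
move=> mD mh; apply: (@measurability _ _ Y (conf R) D _ count_events) => //.
move=> _ [_ [B [n [mB ->]]] <-].
rewrite (_ : D `&` _ = D `&` [set y | [set i | B (graph_point (h y) i)] #= `I_n]).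
  apply: (measurable_count mD (A := fun i => [set y | B (graph_point (h y) i)])) => i.
  exact: (discrete_on_preimage [set a | B (i%:~R, a%:~R)] (mh i)).
by apply/seteqP; split=> y [Dy] /=; rewrite -card_graphI.
Qed.

Lemma translate_graph h (a b : int) :
  translate (a%:~R, b%:~R) (graph h) = graph (fun n => h (n - a) + b).
Proof.
apply/seteqP; split=> [[x y] [n _ [xE yE]]|_ [n _ <-]].
  exists (n + a) => //; rewrite /graph_point/= addrK !intrD xE yE.
  by rewrite /= !subrK.
by exists (n - a) => //; apply: (congr2 pair); rewrite /= ?intrB// intrD addrK.
Qed.

Lemma reroot_graph h (n : int) :
  translate (- graph_point h n) (graph h) = graph (fun m => h (m + n) - h n).
Proof.
rewrite (_ : - graph_point h n = ((- n)%:~R, (- h n)%:~R)).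
  by rewrite translate_graph; under eq_fun do rewrite opprK.
by rewrite !rmorphN.
Qed.

(** The domain on which the block process is equivariant. It contains every realization of the walk
    graph, is stable under re-rooting, and only integer vectors translate one member to another. *)
Definition rooted_graphs : set (conf R) :=
  [set phi | exists h, h 0 = 0 /\ phi = graph h].

Lemma rooted_graphs_root phi : rooted_graphs phi -> phi 0.
Proof. by move=> [h [h0 ->]]; exists 0 => //; rewrite /graph_point h0. Qed.

Lemma rooted_graphs_reroot phi x :
  rooted_graphs phi -> phi x -> rooted_graphs (translate (- x) phi).
Proof.
move=> [h [_ ->]] [n _ <-]; exists (fun m => h (m + n) - h n).
by rewrite add0r subrr reroot_graph.
Qed.

(** The origin of the translate comes from the point [- t] of [phi], whose coordinates are
    integers. *)
Lemma rooted_graphs_translate phi t :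
  rooted_graphs phi -> rooted_graphs (translate t phi) ->
  exists a b : int, t = (a%:~R, b%:~R).
Proof.
move=> [h [_ phiE]] /rooted_graphs_root; rewrite phiE => -[n _].
rewrite /graph_point sub0r => tE; exists (- n), (- h n).
by rewrite -[t]opprK -tE !rmorphN.
Qed.

Lemma rooted_graphs_locally_finite phi :
  rooted_graphs phi -> locally_finite phi.
Proof.
move=> [h [_ ->]] M; pose k := (Num.truncn M).+1.
have Mk : M < k%:R by exact: truncnS_gt.
apply: (@sub_finite_set _ _ (graph_point h @` ((fun i : nat => i%:Z) @` `I_k `|`
  (fun i : nat => - i%:Z) @` `I_k))).
  move=> _ [[n _ <-]] /=; rewrite /Num.norm/= ge_max => /andP[nM _].
  exists n => //; have nk : (`|n| < k)%N.
    by rewrite -(ltr_nat R) natr_absz intr_norm; exact: le_lt_trans nM Mk.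
  by have [n0|n0] := leP 0 n; [left|right]; exists `|n|%N => //=; lia.
by apply: finite_image; rewrite finite_setU; split; apply: finite_image; exact: finite_II.
Qed.

Definition graph_height phi (n : int) : int :=
  xget 0 [set a | phi (n%:~R, a%:~R)].

Lemma graph_heightK h : graph_height (graph h) = h.
Proof.
apply/funext => n; rewrite /graph_height; case: xgetP => [a _ /graphE//|].
by move=> /(_ (h n)) []; exact/graphE.
Qed.

(** Rooted graphs are characterized by counts: no point off the integer lattice, one point on each
    vertical line of integer abscissa, and one point at the origin. *)
Lemma measurable_rooted_graphs : measurable rooted_graphs.
Proof.
pose Z2 : set (R * R) := range (fun p : int * int => (p.1%:~R, p.2%:~R)).
have mZ2 : measurable Z2.
  apply: countable_measurable; first exact: measurable_point.
  by apply: (card_le_trans (card_image_le _ _)); exact: countableP.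
rewrite (_ : rooted_graphs = [set phi | phi `&` ~` Z2 #= `I_0] `&`
  \bigcap_(k in [set: nat]) (if unpickle k is Some n then
     [set phi | phi `&` ([set (n : int)%:~R] `*` setT) #= `I_1] else setT) `&`
  [set phi | phi `&` [set 0] #= `I_1]).
  apply: measurableI; last by apply: measurable_count_event; exact: measurable_point.
  apply: measurableI; first by apply: measurable_count_event; exact: measurableC.
  apply: bigcap_measurable => [|k _]; first by exists 0%N.
  case: unpickle => // n; apply: measurable_count_event; exact: measurableX.
apply/seteqP; split=> [phi [h [h0 ->]]|phi [[/=phiZ phin] phi0]].
  split; first split.
  - rewrite /= card_graphI (_ : [set i | _ (graph_point h i)] = set0) ?II0 ?card_eq00//.
    by apply/seteqP; split=> // i /=; apply; exists (i, h i).
  - move=> k _; case: unpickle => // n; rewrite /= card_graphI.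
    rewrite (_ : [set i | _ (graph_point h i)] = [set n]) ?card_set1//.
    apply/seteqP; split=> [i [/= /eqP + _]|_ ->//].
    by rewrite eqr_int => /eqP.
  - rewrite /= card_graphI (_ : [set i | _ (graph_point h i)] = [set 0]) ?card_set1//.
    apply/seteqP; split=> [i [/= /eqP + _]|_ -> /=].
      by rewrite (_ : 0 = 0%:~R)// eqr_int => /eqP.
    by rewrite /graph_point h0.
have {}phin (n : int) : exists x, phi `&` ([set n%:~R] `*` setT) = [set x].
  have := phin (pickle n) Logic.I; rewrite pickleK => /eq_cardSP[x px E].
  exists x; apply/seteqP; split=> [y py|_ ->//].
  have [//|nyx] := pselect (y = x).
  suff : (phi `&` ([set n%:~R] `*` setT)) `\ x = set0 by move/seteqP => [/(_ y)]; case.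
  by apply/eqP; rewrite -(card_eq0 (U := nat)) (card_eqr (B := `I_0)) // II0.
have phiZ2 : phi `<=` Z2.
  move=> x px; apply: contrapT => nx; move: phiZ; rewrite II0 card_eq0 => /eqP.
  by move/seteqP => [/(_ x)]; case.
pose h n := xget 0 [set a : int | phi (n%:~R, a%:~R)].
have ph n : phi (graph_point h n).
  rewrite /graph_point /h; case: xgetP => // none.
  have [x /seteqP[_ /(_ x erefl)[px [/= xn _]]]] := phin n.
  have [[m a] _ /= xE] := phiZ2 _ px.
  by exfalso; apply: (none a); rewrite -xn; move: px; rewrite -xE.
have phiE : phi = graph h.
  apply/seteqP; split=> [x px|_ [n _ <-]//].
  have [[m a] _ /= xE] := phiZ2 _ px; exists m => //.
  have [y /seteqP[/[dup] yP1 /(_ x) yP _]] := phin m.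
  by rewrite (yP (conj px (conj _ Logic.I))) -?xE// (yP1 (graph_point h m)).
exists h; split=> //; move: phi0; rewrite phiE /= card_graphI => /eq_cardSP[i i0 _].
move: i0 => [/eqP + /eqP]; rewrite (_ : 0 = 0%:~R)// !eqr_int => /eqP -> /eqP.
by [].
Qed.

Lemma discrete_graph_height (n : int) :
  discrete_on rooted_graphs (graph_height^~ n).
Proof.
move=> c.
rewrite (_ : _ `&` _ = rooted_graphs `&`
   [set phi | phi `&` [set (n%:~R, c%:~R)] #= `I_1]).
  apply: measurableI; first exact: measurable_rooted_graphs.
  by apply: measurable_count_event; exact: measurable_point.
apply/seteqP; split=> phi [[h [h0 ->]] /=]; rewrite ?graph_heightK card_graphI.
  move=> hn; split; first by exists h.
  rewrite (_ : [set i | _ (graph_point h i)] = [set n]) ?card_set1//.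
  apply/seteqP; split=> [i [/eqP + _]|_ -> /=]; last by rewrite /graph_point hn.
  by rewrite eqr_int => /eqP.
move=> /eq_cardSP[i [/eqP ni /eqP hi] _].
move: ni hi; rewrite !eqr_int => /eqP -> /eqP hn.
by split=> //; exists h.
Qed.

End IntegerGraphs.

(** * The random block selection *)

(** A shift by one only moves the first term of the period to its end. This is the translation
    invariance of the uniform phase. *)
Lemma sum_periodic (V : nmodType) (F : int -> V) (m : nat) (a : int) :
  (forall i, F (i + m.+1%:Z) = F i) ->
  \sum_(j < m.+1) F (j%:Z + a) = \sum_(j < m.+1) F j%:Z.
Proof.
move=> FL.
have step (G : int -> V) : (forall i, G (i + m.+1%:Z) = G i) ->
    \sum_(j < m.+1) G (j%:Z + 1) = \sum_(j < m.+1) G j%:Z.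
  move=> GL; rewrite big_ord_recr big_ord_recl /= -(GL 0) add0r addrC.
  congr (_ + _); first by congr G; lia.
  by apply: eq_bigr => i _; congr G; rewrite /bump/=; lia.
elim/int_rect: a => [|a <-|a <-]; first by apply: eq_bigr => i _; rewrite addr0.
  rewrite -(step (fun i => F (i + a%:Z))) => [|i]; last by rewrite addrAC FL.
  by apply: eq_bigr => i _; congr F; lia.
rewrite -(step (fun i => F (i - a.+1%:Z))) => [|i]; last by rewrite addrAC FL.
by apply: eq_bigr => i _; congr F; lia.
Qed.

Lemma setI_congr T (D A B : set T) :
  (forall x, D x -> (A x <-> B x)) -> D `&` A = D `&` B.
Proof.
by move=> AB; apply/seteqP; split=> x [Dx]; have := AB x Dx; firstorder.
Qed.

Section BlockLaw.
Context {R : realType} {dX : measure_display} {X : measurableType dX}.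
Variables (a b : X) (r : R) (m : nat).
Implicit Types (h : int -> int) (phi : set (R * R)) (x t : R * R) (j : int).

(* Time from [n] to the end of its block, for blocks of length [m.+1] ending at
   the times congruent to [j]. *)
Definition block_gap j (n : int) : int := ((j - n) %% m.+1%:Z)%Z.

(** Written with points of [phi] and the floor of the abscissa instead of heights, so that it makes
    sense for every configuration and can be compared with its translates. *)
Definition block_select phi j x : Prop :=
  let k := block_gap j (Num.floor x.1) in
  k = 0 \/ exists y, [/\ phi y, y.1 = x.1 + k%:~R & r < `|x.2 - y.2|].

(** One construction serves both dimensions: the marks [a], [b] will be [false], [true] for the
    coverings of fixed radius and the radii 0, [r] for the others. *)
Definition block_mark phi j x : X := if `[< block_select phi j x >] then b else a.

Definition block_marking phi j : marking X phi := fun p => block_mark phi j (val p.1).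
Arguments block_marking : clear implicits.

Definition graph_select h j (n : int) : bool :=
  let k := block_gap j n in (k == 0) || (r < `|h n - h (n + k)|%:~R).

Lemma block_gap_period j n : block_gap (j + m.+1%:Z) n = block_gap j n.
Proof. by rewrite /block_gap addrAC modzDr. Qed.

Lemma block_gap_translate j n k : block_gap j (n + k) = block_gap (j - k) n.
Proof. by rewrite /block_gap; congr modz; lia. Qed.

Lemma block_select_translate phi (c e j : int) x :
  block_select (translate (c%:~R, e%:~R) phi) j x <->
  block_select phi (j - c) (x - (c%:~R, e%:~R)).
Proof.
rewrite /block_select /= -rmorphN floorDrz ?intr_int// intrKfloor.
rewrite block_gap_translate opprK.
rewrite (_ : block_gap (j - c + c) _ = block_gap j (Num.floor x.1)) ?subrK//.
split=> -[->|[y [py yE ry]]]; [by left|right|by left|right].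
  exists (y - (c%:~R, e%:~R)); split=> //=; first by rewrite yE rmorphN/= addrAC.
  by rewrite opprB addrA subrK.
exists (y + (c%:~R, e%:~R)); split.
- by rewrite /translate /= addrK.
- by rewrite /= yE rmorphN/= addrAC subrK.
- by move: ry => /=; rewrite opprD addrA addrAC.
Qed.

Lemma block_select_graph h j n :
  block_select (graph h) j (graph_point h n) <-> graph_select h j n.
Proof.
rewrite /block_select /graph_select /= intrKfloor; set k := block_gap j n.
split=> [[->|[_ [[i _ <-] /= /eqP + +]]]|/orP[/eqP ->|nk]]; [by []| |by left|right].
  by rewrite -intrD eqr_int => /eqP -> ; rewrite -intrB -intr_norm => ->; rewrite orbT.
exists (graph_point h (n + k)); split; [by exists (n + k)|by rewrite /= intrD|].
by rewrite /= -intrB -intr_norm.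
Qed.

Lemma block_mark_graph h j n :
  block_mark (graph h) j (graph_point h n) = if graph_select h j n then b else a.
Proof.
rewrite /block_mark; case: asboolP => [/block_select_graph ->//|ns].
by case: ifP => // /block_select_graph.
Qed.

(** The law of the marking when the phase is uniform on 0, ..., m: an average of Dirac masses. *)
Definition block_measure phi : set (g_sigma_algebraType (@cylinders _ _ X phi)) -> \bar R :=
  mscale (m.+1%:R^-1)%:nng (msum (fun i : nat => @dirac _ (g_sigma_algebraType (@cylinders _ _ X phi))
     (block_marking phi i%:Z) R) m.+1).

HB.instance Definition _ phi := Measure.on (@block_measure phi).

Lemma block_measureE phi (A : set (marking X phi)) :
  block_measure A =
  ((m.+1%:R^-1)%:E * \sum_(i < m.+1) (block_marking phi i%:Z \in A)%:R%:E)%E.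
Proof.
by rewrite /block_measure /mscale /msum /=; congr (_ * _)%E; apply: eq_bigr => j _; rewrite diracE.
Qed.

Fact block_measure_setT phi : @block_measure phi setT = 1%E.
Proof.
rewrite block_measureE; under eq_bigr do rewrite in_setT.
rewrite sumEFin sumr_const card_ord -EFinM -[X in _ * X]mulr_natr mul1r mulVf//.
Qed.

HB.instance Definition _ phi :=
  Measure_isProbability.Build _ _ _ (@block_measure phi) (block_measure_setT phi).

Definition block_law phi : marking_law X phi := @block_measure phi.

Lemma block_lawE phi (A : set (marking X phi)) :
  block_law phi A =
  ((m.+1%:R^-1)%:E * \sum_(i < m.+1) (block_marking phi i%:Z \in A)%:R%:E)%E.
Proof. exact: block_measureE. Qed.

Lemma integral_block_law phi
    (f : g_sigma_algebraType (@cylinders _ _ X phi) -> \bar R) :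
  measurable_fun setT f -> (forall z, 0 <= f z)%E ->
  (\int[block_law phi]_z f z =
   (m.+1%:R^-1)%:E * \sum_(i < m.+1) f (block_marking phi i%:Z))%E.
Proof.
move=> mf f0.
rewrite /block_law /block_measure ge0_integral_mscale// ge0_integral_measure_sum//.
congr (_ * _)%E; apply: eq_bigr => j _.
by rewrite integral_dirac// diracE in_setT mul1e.
Qed.

(** A translation by [c] in time changes the phase by [c], which a sum over a full period of phases
    does not see. *)
Lemma block_law_translate phi (c e : int)
    (A : set (marking X (translate (c%:~R, e%:~R) phi))) :
  block_law (translate (c%:~R, e%:~R) phi) A =
  block_law phi (@translate_marking _ _ X (c%:~R, e%:~R) phi @^-1` A).
Proof.
rewrite !block_lawE; congr (_ * _)%E; set t := (c%:~R, e%:~R).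
pose F (j : int) : \bar R :=
  (block_marking (translate t phi) j \in A)%:R%:E.
rewrite -[LHS](@sum_periodic _ F m c) => [|j]; last first.
  rewrite /F; congr ((_ \in A)%:R%:E); apply/funext => p.
  by rewrite /block_marking /block_mark /block_select block_gap_period.
apply: eq_bigr => j _; rewrite /F.
have -> : block_marking (translate t phi) (j%:Z + c) =
    translate_marking (block_marking phi j%:Z).
  apply/funext => p; rewrite /translate_marking /block_marking /block_mark.
  congr (if _ then b else a); apply: asbool_equiv_eq.
  by rewrite (block_select_translate _ c e) addrK.
by congr (_%:R%:E); apply/idP/idP; rewrite !inE.
Qed.

(** The sets [E] with this property form a sigma-algebra, so counting events suffice. The marked
    point at a pair of times k, l depends on three heights only: at k, at l and at the end of the
    block of k. *)
Lemma measurable_block_event j (E : set (marked_conf X)) :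
  <<s @marked_count_events R dX X >> E ->
  measurable (rooted_graphs `&`
    [set phi : conf R | E (existT _ phi (block_marking phi j))]).
Proof.
pose G := image_set_system (rooted_graphs : set (conf R))
  (fun phi : conf R => existT _ phi (block_marking phi j) : marked_conf X)
  measurable.
suff : <<s @marked_count_events R dX X >> `<=` G by apply.
apply: smallest_sub.
  apply: sigma_algebra_image; split.
  - exact: measurable0.
  - by move=> A mA; apply: measurableD => //; exact: measurable_rooted_graphs.
  - by move=> A mA; exact: bigcupT_measurable.
move=> _ [B [n [mB ->]]]; rewrite /G /image_set_system /=.
pose F h (i : int * int) : (R * R) * (R * R) * X := (graph_point h i.1, graph_point h i.2,
  if graph_select h j i.1 then b else a).
rewrite (_ : _ `&` _ = rooted_graphs `&` [set phi : conf R |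
    [set i | B (F (graph_height phi) i)] #= `I_n]).
  apply: (measurable_count measurable_rooted_graphs
    (A := fun i => [set phi : conf R | B (F (graph_height phi) i)])) => -[k l].
  apply: (discrete_on_preimage (C := (int * int * int)%type)
    (f := fun phi : conf R => (graph_height phi k, graph_height phi l,
       graph_height phi (k + block_gap j k)))
    [set u | B ((k%:~R, u.1.1%:~R), (l%:~R, u.1.2%:~R),
       if (block_gap j k == 0) || (r < `|u.1.1 - u.2|%:~R) then b else a)]).
  by do ![apply: discrete_on_pair]; exact: discrete_graph_height.
apply: setI_congr => phi [h [h0 ->]]; rewrite /= graph_heightK.
rewrite (_ : marked_points _ `&` B = F h @` [set i | B (F h i)]).
  rewrite (card_eql (inj_card_eq _))// => -[k l] [k' l'] _ _.
  move=> /(congr1 (fun u => (u.1.1.1, u.1.2.1)))/= [/eqP + /eqP].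
  by rewrite !eqr_int => /eqP kk /eqP ll; rewrite kk ll.
have gk k : graph_point h k \in (graph h : set (R * R)) by apply/mem_set; exists k.
pose u k : (graph h : set (R * R)) := exist _ (graph_point h k) (gk k).
apply/seteqP; split=> [_ [[[[x xh] [y yh]] _ <-]]|_ [[k l] BF <-]].
  have /set_mem[k _ kx] := xh; have /set_mem[l _ ly] := yh; rewrite -{}kx -{}ly in xh yh *.
  by rewrite /= /block_marking/= block_mark_graph => BF; exists (k, l).
split=> //; exists (u k, u l) => //=.
by rewrite /block_marking/= block_mark_graph.
Qed.

Lemma measurable_block_law (E : set (marked_conf X)) :
  <<s @marked_count_events R dX X >> E ->
  measurable_fun (rooted_graphs : set (conf R))
    (fun phi : conf R => block_law phi [set z | E (existT _ phi z)]).
Proof.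
move=> mE; pose A (i : nat) : set (conf R) :=
  [set phi | E (existT _ phi (block_marking phi i%:Z))].
have mA i : measurable (rooted_graphs `&` A i) by exact: measurable_block_event.
apply: (eq_measurable_fun (fun phi : conf R =>
  (m.+1%:R^-1)%:E * \sum_(i < m.+1) (`[< A i phi >])%:R%:E)%E).
  by move=> phi _; rewrite block_lawE.
apply: measurable_funeM; apply: emeasurable_sum => i.
apply: (measurable_fun_discrete (C := bool) (f := fun phi : conf R => `[< A i phi >])
  (fun c : bool => c%:R%:E)) => -[].
  rewrite (setI_congr (B := A i))// => phi _ /=.
  by split=> [/asboolP|/asboolP].
rewrite (_ : _ `&` _ = rooted_graphs `\` (rooted_graphs `&` A i)).
  by apply: measurableD => //; exact: measurable_rooted_graphs.
apply/seteqP; split=> [phi [Dphi /= /asboolP nA]|phi [Dphi nA]].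
  by split=> // -[].
by split=> //=; apply/asboolP => Ai; apply: nA.
Qed.

Lemma block_law_equivariant {dO : measure_display} {O : measurableType dO}
    (P : probability O R) (Psi : O -> set (R * R)) :
  (forall w, rooted_graphs (Psi w)) -> equivariant_process P Psi block_law.
Proof.
move=> gPsi; exists rooted_graphs; split.
- exact: measurable_rooted_graphs.
- exact: aeW.
- exact: rooted_graphs_locally_finite.
- exact: rooted_graphs_reroot.
- exact: measurable_block_law.
- move=> phi t gphi gt A mA.
  have [c [e tE]] := rooted_graphs_translate gphi gt.
  by move: A mA gt; rewrite tE => A _ _; exact: block_law_translate.
Qed.

End BlockLaw.

(** * Tails of the walk *)

(** From e^y (1 - y) <= e^y e^(-y) = 1 at y = x and y = -x one gets (e^x + e^(-x)) (1 - x^2) <= 2.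
    Moreover 1 <= (1 + 2 x^2) (1 - x^2) because x^2 <= 1/2. *)
Lemma expRD_expRN_le (R : realType) (x : R) : x ^+ 2 <= 2^-1 ->
  expR x + expR (- x) <= 2 * expR (2 * x ^+ 2).
Proof.
move=> x2.
have ex (y : R) : y ^+ 2 <= 2^-1 -> expR y * (1 - y) <= 1.
  move=> y2; rewrite -[leRHS](expRxMexpNx_1 y) ler_wpM2l ?expR_ge0//.
  exact: expR_ge1Dx.
have e1 := ex x x2; have e2 := ex (- x) (eq_ind_r (fun u => u <= 2^-1) x2 (sqrrN x)).
have e3 := expR_ge1Dx (2 * x ^+ 2).
have x21 : 0 < 1 - x ^+ 2 by lra.
have : (expR x + expR (- x)) * (1 - x ^+ 2) <= 2.
  have -> : (expR x + expR (- x)) * (1 - x ^+ 2) =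
    expR x * (1 - x) * (1 + x) + expR (- x) * (1 - - x) * (1 - x) by ring.
  have x1 : 0 <= 1 + x by nra.
  have x1' : 0 <= 1 - x by nra.
  by have := ler_wpM2r x1 e1; have := ler_wpM2r x1' e2; lra.
move=> H; rewrite -(ler_pM2r x21); apply: (le_trans H).
apply: (@le_trans _ _ (2 * (1 + 2 * x ^+ 2) * (1 - x ^+ 2))).
  have : 0 <= x ^+ 2 by exact: sqr_ge0.
  by set y := x ^+ 2 in x2 *; nra.
by rewrite ler_wpM2r ?(ltW x21)// ler_wpM2l.
Qed.

Lemma height_flip (t : int -> int) (k : nat) :
  height (fun i => if i == k.+1 then - t i else t i) k.+1 = height t k - t k.+1.
Proof.
rewrite /height big_ord_recr/= eqxx; congr (_ + _).
by apply: eq_bigr => i _; rewrite ifF//; have := ltn_ord i; lia.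
Qed.

Section WalkTail.
Context {R : realType} {dO : measure_display} {O : measurableType dO}.
Context (P : probability O R) (S : int -> O -> int).
Hypothesis hS : simple_random_walk P S.

Lemma walk_height w : S^~ w = height (fun n => jump S n w).
Proof. by apply: height_unique; [exact: (walk0 hS)|]. Qed.

Lemma fair_jumps_walk : fair_jumps P (jump S).
Proof.
split; [|exact: (walk_jump1 hS)|exact: (walk_jumpN1 hS)|exact: (walk_independent hS)].
move=> n A.
have dS k : discrete_on [set: O] (S k).
  by move=> c; rewrite setTI; exact: (walk_measurable hS).
have := discrete_on_preimage (C := (int * int)%type) [set p | A (p.1 - p.2)]
  (discrete_on_pair (dS n) (dS (n - 1))).
by rewrite setTI.
Qed.

Lemma measurable_walk (f : int -> R) k :
  measurable_fun setT (fun w => (f (S k w))%:E).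
Proof.
apply: (measurable_fun_discrete (C := int) (f := S k) (fun a : int => (f a)%:E)).
by move=> c; rewrite setTI; exact: (walk_measurable hS).
Qed.

Definition walk_mgf (x : R) (k : nat) : \bar R :=
  (\int[P]_w (expR (x * (S k%:Z w)%:~R))%:E)%E.

(* Flipping the last jump preserves the law of the walk, so the moment
   generating function is also the integral of [expR (x S_k) cosh x]. *)
Lemma walk_mgf_step (x : R) (k : nat) : x ^+ 2 <= 2^-1 ->
  (walk_mgf x k.+1 <= (expR (2 * x ^+ 2))%:E * walk_mgf x k)%E.
Proof.
move=> x2; have fJ := fair_jumps_walk.
pose f (t : path) : \bar R := (expR (x * (height t k.+1)%:~R))%:E.
have mf : measurable_fun setT f.
  apply: (measurable_fun_discrete (C := int) (f := fun t : path => height t k.+1)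
    (fun a : int => (expR (x * a%:~R))%:E)).
  exact: discrete_height.
have f0 t : (0 <= f t)%E by rewrite lee_fin expR_ge0.
have E1 : walk_mgf x k.+1 = (\int[P]_w (expR (x * (S k%:Z w)%:~R) *
    expR (x * (jump S k.+1 w)%:~R))%:E)%E.
  apply: eq_integral => w _; rewrite -expRD -mulrDr -intrD; congr (expR (x * _%:~R))%:E.
  by rewrite /jump (_ : Posz k.+1 - 1 = k); [rewrite addrC subrK|lia].
have E2 : walk_mgf x k.+1 = (\int[P]_w (expR (x * (S k%:Z w)%:~R) *
    expR (- (x * (jump S k.+1 w)%:~R)))%:E)%E.
  transitivity (\int[P]_w f (path_of (jump S) w))%E.
    by apply: eq_integral => w _; rewrite /f /path_of -walk_height.
  rewrite (fair_jumps_integral fJ (fair_jumps_flip k.+1 fJ) mf f0).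
  apply: eq_integral => w _; rewrite /f -expRD -mulrN -mulrDr -intrN -intrD.
  congr (expR (x * _%:~R))%:E; rewrite height_flip -walk_height.
  by [].
have mS (g : int -> int -> R) : measurable_fun setT (fun w => (g (S k%:Z w) (jump S k.+1 w))%:E).
  apply: (measurable_fun_discrete (C := (int * int)%type)
    (f := fun w => (S k%:Z w, jump S k.+1 w)) (fun p => (g p.1 p.2)%:E)).
  apply: discrete_on_pair => c; rewrite setTI; first exact: (walk_measurable hS).
  exact: (fair_measurable fJ).
(* Adding [E1] and [E2] produces the factor e^x + e^(-x) wherever the jump is 1 or -1, that is, off
   a null set. *)
suff : (walk_mgf x k.+1 + walk_mgf x k.+1 <=
    (2 * expR (2 * x ^+ 2))%:E * walk_mgf x k)%E.
  have -> : ((2 * expR (2 * x ^+ 2))%:E * walk_mgf x k =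
    2%:E * ((expR (2 * x ^+ 2))%:E * walk_mgf x k))%E by rewrite EFinM muleA.
  by rewrite -mule2n -mule_natl lee_pmul2l.
rewrite {1}E1 E2 -ge0_integralD//; last 2 first.
- exact: (mS (fun a b => expR (x * a%:~R) * expR (x * b%:~R))).
- exact: (mS (fun a b => expR (x * a%:~R) * expR (- (x * b%:~R)))).
rewrite -ge0_integralZl_EFin//; last first.
  exact: (mS (fun a b => expR (x * a%:~R))).
apply: ae_ge0_le_integral => //.
- by move=> w _; rewrite -EFinD lee_fin addr_ge0 ?mulr_ge0 ?expR_ge0.
- exact: (mS (fun a b => expR (x * a%:~R) * expR (x * b%:~R) +
     expR (x * a%:~R) * expR (- (x * b%:~R)))).
- exact: (mS (fun a b => 2 * expR (2 * x ^+ 2) * expR (x * a%:~R))).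
exists [set w | jump S k.+1 w != 1 /\ jump S k.+1 w != -1]; split.
- exact: (fair_measurable fJ _ [set a | a != 1 /\ a != -1]).
- exact: fair_jump_ae.
- move=> w /= /not_implyP[_ nle]; split; apply/eqP => J1; apply: nle;
  rewrite J1 -EFinD -EFinM lee_fin -mulrDr mulrC ler_wpM2r ?expR_ge0//.
    by rewrite mulr1; exact: expRD_expRN_le.
  by rewrite mulrN1 opprK addrC; exact: expRD_expRN_le.
Qed.

Lemma walk_mgf_le (x : R) (k : nat) : x ^+ 2 <= 2^-1 ->
  (walk_mgf x k <= (expR (2 * x ^+ 2 *+ k))%:E)%E.
Proof.
move=> x2; elim: k => [|k IH].
  rewrite /walk_mgf; under eq_integral do rewrite (walk0 hS) mulr0 expR0.
  rewrite (integral_cst P measurableT 1%E) mulr0n expR0.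
  by rewrite mul1e; exact: probability_le1.
apply: (le_trans (walk_mgf_step _ x2)); rewrite (mulrS (2 * x ^+ 2)) expRD EFinM.
by apply: lee_wpmul2l => //; rewrite lee_fin expR_ge0.
Qed.

(** Chernoff bound for both signs at once: on the event, e^(x r) is at most e^(x S_k) + e^(-x
    S_k). *)
Lemma walk_tail (x r : R) (k : nat) : 0 <= x -> x ^+ 2 <= 2^-1 ->
  (P [set w | (r < `|S k%:Z w|%:~R)%R] <=
    (2 * expR (2 * x ^+ 2 *+ k - x * r))%:E)%E.
Proof.
move=> x0 x2; set A := [set w | _].
have mA : measurable A by exact: (walk_measurable hS k [set a | r < `|a|%:~R]).
have H : ((expR (x * r))%:E * P A <= walk_mgf x k + walk_mgf (- x) k)%E.
  rewrite -[A]setIT -integral_indic// -ge0_integralZl_EFin ?expR_ge0//; last first.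
    exact/measurable_EFinP/measurable_indic.
  rewrite /walk_mgf -ge0_integralD//; last 2 first.
  - exact: (measurable_walk (fun a => expR (x * a%:~R))).
  - exact: (measurable_walk (fun a => expR (- x * a%:~R))).
  apply: ge0_le_integral_nomeas => w.
    by rewrite mule_ge0 ?lee_fin ?expR_ge0.
  rewrite -EFinD -EFinM lee_fin indicE; case: (boolP (w \in A)); last first.
    by rewrite mulr0 addr_ge0 ?expR_ge0.
  rewrite inE /A /= mulr1 => rS; have [S0|S0] := leP 0 (S k%:Z w).
    apply: (@le_trans _ _ (expR (x * (S k%:Z w)%:~R))); last by rewrite lerDl expR_ge0.
    by rewrite ler_expR ler_wpM2l// ltW//; rewrite ger0_norm in rS.
  apply: (@le_trans _ _ (expR (- x * (S k%:Z w)%:~R))); last by rewrite lerDr expR_ge0.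
  rewrite ler_expR mulNr -mulrN ler_wpM2l// ltW//.
  by rewrite ltr0_norm// intrN in rS.
have e0 : 0 < expR (x * r) by exact: expR_gt0.
rewrite -(@lee_pmul2l _ (expR (x * r))%:E)//.
apply: (le_trans H); rewrite -EFinM mulrCA -expRD [x * r + _]addrC subrK.
have xN2 : (- x) ^+ 2 <= 2^-1 by rewrite sqrrN.
apply: (le_trans (leeD (walk_mgf_le k x2) (walk_mgf_le k xN2))).
by rewrite sqrrN -EFinD lee_fin; lra.
Qed.

End WalkTail.

(** * Coverings by block selection *)

Section Marks.
Context {R : realType} {dX : measure_display} {X : measurableType dX}.
Implicit Types (phi : set (R * R)) (x : R * R).

Lemma markE phi (z : marking X phi) (u : phi) : mark z (val u) = z (u, u).
Proof.
have := congr1 (fun g => g u) (@valLK _ _ point phi (fun u : phi => z (u, u))).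
exact.
Qed.

Lemma measurable_mark phi x (B : set X) : phi x -> measurable B ->
  measurable ([set z | B (mark z x)] : set (g_sigma_algebraType (@cylinders _ _ X phi))).
Proof.
move=> /mem_set px mB; pose u : phi := exist _ x px.
apply: sub_sigma_algebra; exists (u, u), B; split=> //.
by apply/seteqP; split=> z; rewrite /= -(markE z u).
Qed.

Lemma measurable_fun_mark phi x d (Y : measurableType d) (f : X -> Y) :
  phi x -> measurable_fun setT f ->
  measurable_fun (setT : set (g_sigma_algebraType (@cylinders _ _ X phi)))
    (fun z => f (mark z x)).
Proof.
move=> px mf _ B mB; rewrite setTI.
apply: (measurable_mark px (B := f @^-1` B)).
by rewrite -[_ @^-1` _]setTI; exact: mf.
Qed.

Variables (a b : X) (r : R) (m : nat).

Lemma mark_block_marking phi j x : phi x ->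
  mark (block_marking a b r m (phi := phi) j) x = block_mark a b r m phi j x.
Proof. by move=> /mem_set px; rewrite (markE _ (exist _ x px : phi)). Qed.

(** The law is carried by the union of the events [C j], which prescribe the marks of phase [j] at
    all times. These are measurable because there are countably many times. *)
Lemma block_law_ae_graph h (Q : marking X (graph (R := R) h) -> Prop) :
  measurable [set a] -> measurable [set b] ->
  (forall j z, (forall n, mark z (graph_point h n) =
    if graph_select r m h j n then b else a) -> Q z) ->
  {ae block_law a b r m (graph h), forall z, Q z}.
Proof.
move=> ma mb HQ; have gh n : (graph h : set (R * R)) (graph_point h n) by exists n.
pose c j n := if graph_select r m h j n then b else a.
pose C (j : nat) : set (g_sigma_algebraType (@cylinders _ _ X (graph (R := R) h))) :=
  \bigcap_(k in [set: nat]) if unpickle k is Some n then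
    [set z | [set c j%:Z n] (mark z (graph_point (R := R) h n))] else setT.
have mC j : measurable (C j).
  apply: bigcap_measurable => [|k _]; first by exists 0%N.
  case: unpickle => // n; apply: measurable_mark; first exact: gh.
  by rewrite /c; case: ifP.
exists (~` \bigcup_(j in [set: nat]) C j); split.
- by apply: measurableC; apply: bigcupT_measurable.
- rewrite block_lawE big1 ?mule0// => j _.
  rewrite memNset// => -[]; exists j => // k _.
  by case: unpickle => // n; rewrite /= mark_block_marking ?block_mark_graph//.
- apply: subsetC => z [j _ Cz]; apply: (HQ j) => n.
  by have := Cz (pickle n) Logic.I; rewrite pickleK.
Qed.

End Marks.

(** A time that is not selected is covered by the end of its block: at most m <= r^2 steps separate
    them, and the heights differ by at most [r] precisely because the time was not selected. *)
Lemma graph_select_cover (R : realType) (r : R) (m : nat) h j n :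
  1 <= r -> m%:R <= r ^+ 2 ->
  exists k, graph_select r m h j k /\
    parabolic_dist (graph_point h k) (graph_point h n) <= r.
Proof.
move=> r1 mr; have r0 : 0 <= r by lra.
have [jn|] := boolP (graph_select r m h j n).
  exists n; split=> //.
  by rewrite /parabolic_dist !subrr normr0 sqrtr0 ge_max r0.
rewrite /graph_select negb_or -leNgt; set k := block_gap m j n => /andP[_ hk].
have k0 : 0 <= k by exact: modz_ge0.
have km : k <= m%:Z by have : k < m.+1%:Z := ltz_pmod (j - n) (isT : 0 < m.+1%:Z); lia.
exists (n + k); split.
  by rewrite /block_gap opprD addrA -modzDml subrr mod0z eqxx.
rewrite /parabolic_dist ge_max /=.
have -> : `|(h (n + k))%:~R - (h n)%:~R| = `|h n - h (n + k)|%:~R :> R.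
  by rewrite -intrB -intr_norm distrC.
have -> : `|(n + k)%:~R - n%:~R| = k%:~R :> R.
  by rewrite -intrB addrAC subrr add0r -intr_norm ger0_norm.
rewrite hk andbT -[leRHS](ger0_norm r0) -sqrtr_sqr ler_wsqrtr// (le_trans _ mr)//.
by rewrite (_ : m%:R = m%:Z%:~R)// ler_int.
Qed.

Section RadiusMeasurability.
Context {R : realType}.

Lemma measurable_radius_val : measurable_fun setT (@radius_val R : radiusM R -> R).
Proof. by move=> _ B mB; exists B. Qed.

Lemma measurable_pow0 (al : R) :
  measurable_fun setT (fun u : radiusM R => pow0 (radius_val u) al).
Proof.
apply: (measurableT_comp (f := fun s : R => pow0 s al)); last exact: measurable_radius_val.
apply: measurable_fun_ifT; [exact: measurable_fun_eqr|by []|exact: measurable_powR].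
Qed.

Lemma measurable_radius1 (u : radiusM R) : measurable [set u].
Proof.
exists [set radius_val u] => //; rewrite setTI.
by apply/seteqP; split=> [v /= /val_inj//|v ->].
Qed.

Lemma pow0_ge0 (s al : R) : 0 <= pow0 s al.
Proof. by rewrite /pow0; case: ifP => // _; exact: powR_ge0. Qed.

End RadiusMeasurability.

Section WalkCoverings.
Context {R : realType} {dO : measure_display} {O : measurableType dO}.
Context (P : probability O R) (S : int -> O -> int).
Hypothesis hS : simple_random_walk P S.
Variables (r : R) (m : nat) (tau : R).
Hypothesis r1 : 1 <= r.
Hypothesis mr : m%:R <= r ^+ 2.
Hypothesis tail : forall j : nat, (j <= m)%N ->
  (P [set w | (r < `|S j%:Z w|%:~R)%R] <= tau%:E)%E.
Local Notation Psi := (walk_graph S).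

Lemma walk_graph_rooted w : rooted_graphs (walk_graph S w : set (R * R)).
Proof. by exists (S^~ w); split=> //; exact: (walk0 hS). Qed.

Lemma walk_graph0 w : (walk_graph S w : set (R * R)) 0.
Proof. exact: rooted_graphs_root (walk_graph_rooted w). Qed.

Lemma walk_graph_point0 w : 0 = graph_point (S^~ w) 0 :> R * R.
Proof. by rewrite /graph_point (walk0 hS). Qed.

Lemma block_gap0 (j : 'I_m.+1) : block_gap m j 0 = j.
Proof. by rewrite /block_gap subr0 modz_small//= ltz_nat ltn_ord. Qed.

Lemma measurable_graph_select (j n : int) :
  measurable [set w | graph_select r m (S^~ w) j n].
Proof.
have dS k : discrete_on [set: O] (S k).
  by move=> c; rewrite setTI; exact: (walk_measurable hS).
have := discrete_on_preimage (C := (int * int)%type)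
  [set p | (block_gap m j n == 0) || (r < `|p.1 - p.2|%:~R)]
  (discrete_on_pair (dS n) (dS (n + block_gap m j n))).
by rewrite setTI.
Qed.

(** For phase 0 the origin ends its block, which costs at most 1. For another phase j its block ends
    at time j, and selection means |S_j| > r, of probability at most [tau]. The factor [c] is 1 for
    intensities and r^al for contents. *)
Lemma integral_graph_select (c : R) : 0 <= c ->
  (\int[P]_w ((m.+1%:R^-1)%:E * \sum_(j < m.+1)
     (c * (graph_select r m (S^~ w) j 0)%:R)%:E) <=
  (c * (m.+1%:R^-1 + tau))%:E)%E.
Proof.
move=> c0; have m0 : 0 <= m.+1%:R^-1 :> R by rewrite invr_ge0.
have tau0 : 0 <= tau.
  by rewrite -lee_fin (le_trans _ (tail (leq0n m))).
pose A (j : 'I_m.+1) := [set w | graph_select r m (S^~ w) j 0].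
have cA (j : 'I_m.+1) w : (c * (graph_select r m (S^~ w) j 0)%:R)%:E = (c%:E * (\1_(A j) w)%:E)%E.
  have Aw : (w \in A j) = graph_select r m (S^~ w) j 0.
    by apply/idP/idP; rewrite inE.
  by rewrite -EFinM indicE Aw.
have mA (j : 'I_m.+1) : measurable_fun setT (fun w => (\1_(A j) w)%:E : \bar R).
  by apply/measurable_EFinP; apply: measurable_indic; exact: measurable_graph_select.
under eq_integral do under eq_bigr do rewrite cA.
rewrite ge0_integralZl_EFin//; last 2 first.
- by move=> w _; apply: sume_ge0 => j _; rewrite mule_ge0 ?lee_fin.
- by apply: emeasurable_sum => j; exact: measurable_funeM.
rewrite ge0_integral_sum//; last 2 first.
- by move=> j; exact: measurable_funeM.
- by move=> j w _; rewrite mule_ge0 ?lee_fin.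
have bound (j : 'I_m.+1) : (\int[P]_w (c%:E * (\1_(A j) w)%:E) <=
    (c * ((j == ord0)%:R + tau))%:E)%E.
  rewrite ge0_integralZl_EFin// integral_indic ?setIT//; last exact: measurable_graph_select.
  rewrite EFinM lee_wpmul2l ?lee_fin// EFinD.
  have [->|j0] := eqVneq j ord0.
    apply: (@le_trans _ _ 1%E); first by apply: probability_le1; exact: measurable_graph_select.
    by rewrite leeDl ?lee_fin.
  rewrite add0e (_ : A j = [set w | r < `|S j%:Z w|%:~R]); first exact: tail (ltn_ord j).
  apply/seteqP; split=> w; rewrite /A /= /graph_select block_gap0 add0r (walk0 hS) sub0r normrN.
    by case/orP => // /eqP [j0']; case/eqP: j0; exact: val_inj.
  by move=> ->; rewrite orbT.
apply: (@le_trans _ _ ((m.+1%:R^-1)%:E * \sum_(j < m.+1) (c * ((j == ord0)%:R + tau))%:E)%E).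
  by rewrite lee_wpmul2l ?lee_fin//; apply: lee_sum => j _; exact: bound.
rewrite sumEFin -EFinM lee_fin -mulr_sumr big_split/= sumr_const card_ord.
rewrite (bigD1 ord0)//= big1 ?addr0 => [|j /negbTE ->//].
rewrite mulrCA ler_wpM2l// mulrDr mulr1 lerD2l -[tau *+ _]mulr_natl mulKf//.
Qed.

Lemma block_rcovering :
  equivariant_rcovering P Psi parabolic_dist r (block_law false true r m).
Proof.
split; first exact: block_law_equivariant walk_graph_rooted.
apply: aeW => w; apply: block_law_ae_graph => // j z zE _ [n _ <-].
have [k [ks kd]] := graph_select_cover (S^~ w) j n r1 mr.
exists (graph_point (S^~ w) k).
  by split; [exists k|rewrite zE ks].
rewrite /cball (gt_eqF (lt_le_trans ltr01 r1)).
by split=> //; exists n.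
Qed.

Lemma lambda_le : (lambda P Psi parabolic_dist r <= (m.+1%:R^-1 + tau)%:E)%E.
Proof.
apply: (@le_trans _ _ (intensity P Psi (block_law false true r m))).
  by apply: ereal_inf_lbound; exists (block_law false true r m) => //; exact: block_rcovering.
rewrite -[(_ + tau)]mul1r; apply: le_trans (integral_graph_select ler01).
rewrite /intensity le_eqVlt; apply/orP; left; apply/eqP.
apply: eq_integral => w _; rewrite block_lawE; congr (_ * _)%E.
apply: eq_bigr => j _; rewrite mul1r.
have E : mark (block_marking false true r m (phi := Psi w) j) 0 = graph_select r m (S^~ w) j 0.
  rewrite mark_block_marking; last exact: walk_graph0.
  by rewrite (walk_graph_point0 w) block_mark_graph; case: ifP.
have -> : (block_marking false true r m (phi := Psi w) j \in
    [set z | marked_subset z 0]) = graph_select r m (S^~ w) j 0.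
  apply/idP/idP; rewrite inE /marked_subset /= E; first by case.
  by move=> ->; split=> //; exact: walk_graph0.
by [].
Qed.

Let zero_radius : radiusM R := exist _ 0 (radius0_subproof R).
Fact block_radius_subproof : (r == 0) || (1 <= r).
Proof. by rewrite r1 orbT. Qed.
Let block_radius : radiusM R := exist _ r block_radius_subproof.

Lemma block_covering : equivariant_covering P Psi parabolic_dist
  (block_law zero_radius block_radius r m).
Proof.
split; first exact: block_law_equivariant walk_graph_rooted.
apply: aeW => w; apply: block_law_ae_graph => [||j z zE _ [n _ <-]];
  [exact: measurable_radius1|exact: measurable_radius1|].
have [k [ks kd]] := graph_select_cover (S^~ w) j n r1 mr.
exists (graph_point (S^~ w) k); first by exists k.
rewrite /mark_radius zE ks /= /radius_val /= /cball (gt_eqF (lt_le_trans ltr01 r1)).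
by split=> //; exists n.
Qed.

Lemma hcontent1_le (al : R) :
  (hcontent1 P Psi parabolic_dist al <= (r `^ al * (m.+1%:R^-1 + tau))%:E)%E.
Proof.
pose Z := block_law zero_radius block_radius r m.
apply: (@le_trans _ _ (\int[P]_w \int[Z (Psi w)]_z (pow0 (mark_radius z 0) al)%:E)%E).
  by apply: ereal_inf_lbound; exists Z => //; exact: block_covering.
apply: le_trans (integral_graph_select (powR_ge0 r al)).
rewrite le_eqVlt; apply/orP; left; apply/eqP.
apply: eq_integral => w _; rewrite integral_block_law; last 2 first.
- apply/measurable_EFinP.
  exact: (measurable_fun_mark (walk_graph0 w) (measurable_pow0 al)).
- by move=> z; rewrite lee_fin pow0_ge0.
congr (_ * _)%E; apply: eq_bigr => j _; congr (_%:E).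
rewrite /mark_radius mark_block_marking; last exact: walk_graph0.
rewrite (walk_graph_point0 w) block_mark_graph.
case: (graph_select _ _ _ _ _); rewrite /radius_val/= /pow0.
  by rewrite (gt_eqF (lt_le_trans ltr01 r1)) mulr1.
by rewrite eqxx mulr0.
Qed.

End WalkCoverings.

(** * Mass transport *)

Section MassTransport.
Context {R : realType} {dX : measure_display} {X : measurableType dX}.

(** The event that the origin has its mark in [B], phrased as a count so that it belongs to the
    generators of the sigma-algebra. *)
Definition origin_event (B : set X) : set (marked_conf X) :=
  [set m : marked_conf X | marked_points m `&` ([set ((0, 0) : (R * R) * (R * R))] `*` B) #= `I_1].

Lemma sigma_origin_event (B : set X) : measurable B ->
  <<s @marked_count_events R dX X >> (origin_event B).
Proof.
move=> mB; apply: sub_sigma_algebra; exists ([set (0, 0)] `*` B), 1%N; split=> //.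
apply: measurableX => //.
rewrite (_ : [set (0, 0)] = [set 0] `*` [set 0]).
  by apply: measurableX; exact: measurable_point.
by apply/seteqP; split=> [_ ->//|[c e] [/= -> ->]].
Qed.

Lemma origin_eventE (B : set X) (phi : set (R * R)) (z : marking X phi) : phi 0 ->
  origin_event B (existT _ phi z) <-> B (mark z 0).
Proof.
move=> /mem_set p0; pose u : phi := exist _ 0 p0.
have zu : mark z 0 = z (u, u) by rewrite -markE.
split=> [/eq_cardSP[_ [[[v v'] _ <-] [/= [v0 v0'] Bz]] _]|Bz].
  have -> : mark z 0 = z (v, v') by rewrite zu; congr (z (_, _)); exact: val_inj.
  exact: Bz.
rewrite /origin_event /= (_ : _ `&` _ = [set (0, 0, mark z 0)]) ?card_set1//.
apply/seteqP; split=> [_ [[[v v'] _ <-] [/= [v0 v0'] _]]|_ ->].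
  rewrite /= v0 v0' zu; congr (0, 0, z (_, _)); exact: val_inj.
by split=> //; exists (u, u) => //; rewrite /= zu.
Qed.

Lemma mark_translate (phi : set (R * R)) (x : R * R) (z : marking X phi) :
  phi x -> mark (translate_marking (t := - x) z) 0 = mark z x.
Proof.
move=> px; have p0 : 0 \in translate (- x) phi.
  by apply/mem_set; rewrite /translate /= opprK add0r.
pose u : translate (- x) phi := exist _ 0 p0.
rewrite -[0]/(val u) markE /translate_marking /= -markE; congr mark.
by rewrite /= opprK add0r.
Qed.

Context {dO : measure_display} {O : measurableType dO} (P : probability O R).
Context (S : int -> O -> int).
Hypothesis hS : simple_random_walk P S.
Variable Z : forall phi : set (R * R), marking_law X phi.
Hypothesis eqZ : equivariant_process P (@walk_graph R dO O S) Z.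
Local Notation Psi := (@walk_graph R dO O S).

(* [B k] collects the marks with which a point at time distance [k] covers the
   origin.  By stationarity of the increments such a point has its mark in [B k]
   as often as the origin does; the factor 2 counts the times [k] and [- k]. *)
Lemma mass_transport (B : nat -> set X) (f : X -> \bar R) (c : R) :
  0 < c -> (forall u, 0 <= f u)%E -> (forall k, measurable (B k)) -> measurable_fun setT f ->
  (forall u, (\sum_(0 <= k <oo) (\1_(B k) u)%:E <= c%:E * f u)%E) ->
  {ae P, forall w, {ae Z (Psi w), forall z,
    exists n : int, B `|n|%N (mark z (graph_point (S^~ w) n))}} ->
  (1 <= (2 * c)%:E * \int[P]_w \int[Z (Psi w)]_z f (mark z 0%R))%E.
Proof.
move=> c0 f0 mB mf Bf aeB; have [D hD] := eqZ.
have mD := equivariant_measurable hD.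
(* The probability that the origin has its mark in [B k], set to 0 off [D], where [Z] is not
   controlled, to obtain a measurable function of all configurations. *)
pose g k : conf R -> \bar R :=
  (fun phi : conf R => Z phi [set z | origin_event (B k) (existT _ phi z)]) \_ D.
have mg k : measurable_fun setT (g k).
  apply/(measurable_restrictT _ mD).
  by apply: (equivariant_measurable_fun hD); exact: sigma_origin_event.
have g0 k phi : (0 <= g k phi)%E by rewrite /g /patch; case: ifP.
have gE k phi : D phi -> phi 0 -> g k phi = Z phi [set z | B k (mark z 0)].
  move=> Dphi phi0; rewrite /g patchE mem_set//; congr (Z phi _).
  by apply/seteqP; split=> z /= /origin_eventE; apply.
pose G k (t : path) := g k (graph (height t)).
have mG k : measurable_fun setT (G k).
  apply: (measurableT_comp (mg k)); apply: (measurable_graph measurableT) => n.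
  exact: discrete_height.
pose J n : int -> O -> int := fun i => jump S (i + n).
have fJ n : fair_jumps P (J n) by apply: fair_jumps_shift; exact: fair_jumps_walk hS.
(* Equivariance moves the point at time [n] to the origin, and the re-rooted graph is that of the
   shifted jumps. *)
have GE k n w : D (Psi w) ->
    Z (Psi w) [set z | B k (mark z (graph_point (S^~ w) n))] = G k (path_of (J n) w).
  move=> Dw; have Pn : (Psi w : set (R * R)) (graph_point (S^~ w) n) by exists n.
  pose x : R * R := graph_point (S^~ w) n.
  have Dx := equivariant_reroot hD Dw Pn.
  have p0 : translate (- x) (Psi w) 0 by rewrite /translate /= opprK add0r.
  rewrite /G (_ : graph _ = translate (- x) (Psi w)); last first.
    rewrite [RHS]reroot_graph; congr graph; apply/funext => i.
    by rewrite /path_of /J (height_shift (fun i => jump S i w)) -(walk_height hS).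
  rewrite gE//= (equivariant_translate hD Dw Dx); last exact: measurable_mark.
  by congr (Z _ _); apply/seteqP; split=> z /=; rewrite mark_translate.
have intG k n : (\int[P]_w G k (path_of (J n) w) = \int[P]_w g k (Psi w))%E.
  rewrite (fair_jumps_integral (fJ n) (fair_jumps_walk hS) (mG k)); last by move=> t; exact: g0.
  apply: eq_integral => w _; congr (g k (graph _)).
  by rewrite /path_of -(walk_height hS).
have mGJ k n : measurable_fun setT (fun w => G k (path_of (J n) w)).
  apply: (measurableT_comp (mG k)); apply: measurable_path_of.
  exact: fair_measurable (fJ n).
have [N [mN N0 NB]] : {ae P, forall w, D (Psi w) /\ {ae Z (Psi w), forall z,
    exists n : int, B `|n|%N (mark z (graph_point (S^~ w) n))}}.
  by apply: filterS2 (equivariant_ae hD) aeB => w.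
(* Union bound over the distance k and the times k and -k; time 0 is counted twice, which is
   harmless. *)
have key w : ((\1_(~` N) w)%:E <=
    \sum_(0 <= k <oo) (G k (path_of (J k%:Z) w) + G k (path_of (J (- k%:Z)%R) w)))%E.
  have series0 : (0 <= \sum_(0 <= k <oo)
      (G k (path_of (J k%:Z) w) + G k (path_of (J (- k%:Z)%R) w)))%E.
    by apply: nneseries_ge0 => k _ _; apply: adde_ge0; exact: g0.
  rewrite indicE; case: (boolP (w \in ~` N)) => // /set_mem Nw.
  have [Dw [M [mM M0 MB]]] : D (Psi w) /\ {ae Z (Psi w), forall z,
      exists n : int, B `|n|%N (mark z (graph_point (S^~ w) n))}.
    by apply: contrapT => H; apply: Nw; exact: NB.
  have Pn n : (Psi w : set (R * R)) (graph_point (S^~ w) n) by exists n.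
  pose A n k : set (g_sigma_algebraType (@cylinders _ _ X (Psi w))) :=
    [set z : marking X (Psi w) | B k (mark z (graph_point (S^~ w) n))].
  have mA n k : measurable (A n k) by exact: measurable_mark.
  have <- : Z (Psi w) (~` M) = 1%E.
    by rewrite probability_setC// M0 sube0.
  apply: (@le_trans _ _ (\sum_(0 <= k <oo) Z (Psi w) (A k%:Z k `|` A (- k%:Z)%R k))%E).
    apply: measure_sigma_subadditive => [k||z Mz]; [exact: measurableU|exact: measurableC|].
    have [n Bn] : exists n : int, B `|n|%N (mark z (graph_point (S^~ w) n)).
      by apply: contrapT => H; apply: Mz; exact: MB.
    exists `|n|%N => //; have [n0|n0] := leP 0 n; [left|right]; rewrite /A /=.
      by have -> : `|n|%N%:Z = n by lia.
    by have -> : - `|n|%N%:Z = n by lia.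
  apply: lee_nneseries => [k _ _//|k _].
  apply: (le_trans (measureU2 (Z (Psi w)) (mA _ _) (mA _ _))).
  by rewrite -!GE.
have : (1 <= \int[P]_w \sum_(0 <= k <oo)
    (G k (path_of (J k%:Z) w) + G k (path_of (J (- k%:Z)%R) w)))%E.
  have <- : (\int[P]_w (\1_(~` N) w)%:E = 1)%E.
    have PN : P (~` N) = 1%E by rewrite probability_setC// N0 sube0.
    by rewrite integral_indic// ?setIT//; exact: measurableC.
  by apply: ge0_le_integral_nomeas => w //; rewrite lee_fin.
move=> /le_trans; apply; rewrite integral_nneseries//; last 2 first.
- by move=> k; exact: emeasurable_funD.
- by move=> k w _; apply: adde_ge0; exact: g0.
have mgPsi k : measurable_fun setT (fun w => g k (Psi w)).
  apply: (measurableT_comp (mg k)); apply: (measurable_graph measurableT) => n u.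
  by rewrite setTI; exact: (walk_measurable hS).
(* The times k and -k contribute equally. Writing 2 as 2c times the inverse of c, it remains to
   bound the sum over k of [g k] pointwise by c times the inner integral of [f]. *)
rewrite (eq_eseriesr (g := fun k => ((2 * c)%:E * \int[P]_w ((c^-1)%:E * g k (Psi w)))%E)); last first.
  move=> k _; rewrite ge0_integralD//; [|by move=> *; exact: g0|by move=> *; exact: g0].
  rewrite !intG ge0_integralZl_EFin ?invr_ge0 ?(ltW c0)//.
  by rewrite muleA -EFinM mulfK ?gt_eqF// -mule2n mule_natl.
have gc0 k w : (0 <= (c^-1)%:E * g k (Psi w))%E.
  by apply: mule_ge0; rewrite ?lee_fin ?invr_ge0 ?(ltW c0).
rewrite nneseriesZl; last by move=> k _; apply: integral_ge0.
rewrite lee_pmul2l ?lte_fin ?mulr_gt0// -integral_nneseries//; last first.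
  by move=> k; exact: measurable_funeM.
apply: ge0_le_integral_nomeas => w.
  by apply: nneseries_ge0 => k _ _.
have [Dw|nD] := pselect (D (Psi w)); last first.
  rewrite eseries0; first by apply: integral_ge0 => z _; exact: f0.
  by move=> k _ _; rewrite /g patchE memNset// mule0.
have P0 := walk_graph0 hS w.
rewrite nneseriesZl; last by move=> k _; exact: g0.
rewrite muleC lee_pdivrMr// muleC.
rewrite -ge0_integralZl_EFin ?(ltW c0)//; last exact: measurable_fun_mark P0 mf.
rewrite (eq_eseriesr (g := fun k => (\int[Z (Psi w)]_z (\1_(B k) (mark z 0%R))%:E)%E)); last first.
  move=> k _; rewrite gE// -[in LHS](setIT [set z | _]) -integral_indic//; last first.
    exact: measurable_mark.
rewrite -integral_nneseries//; last first.
  move=> k; apply: (measurable_fun_mark P0 (f := fun u => (\1_(B k) u)%:E)).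
  exact/measurable_EFinP/measurable_indic.
by apply: ge0_le_integral_nomeas => z //; apply: nneseries_ge0 => k _ _; rewrite lee_fin.
Qed.

End MassTransport.

(** * Lower bounds for intensities and contents of coverings *)

Section Asymptotics.
Context {R : realType} {dO : measure_display} {O : measurableType dO}.
Context (P : probability O R) (S : int -> O -> int).
Hypothesis hS : simple_random_walk P S.
Local Notation Psi := (@walk_graph R dO O S).

(** At most s + 1 natural numbers are below s, and s >= 1 absorbs the 1. *)
Lemma nneseries_indic_le (s : R) : 1 <= s ->
  (\sum_(0 <= k <oo) ((k%:R <= s)%R%:R)%:E <= (2 * s)%:E)%E.
Proof.
move=> s1; pose n := (Num.truncn s).+1.
have sE (k : nat) : (k%:R <= s) = (k < n)%N.
  by rewrite ltnS truncn_ge_nat//; lra.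
rewrite (nneseries_split 0 n)// add0n [X in (_ + X)%E]eseries0 ?adde0; last first.
  by move=> k nk _; rewrite sE ltnNge nk.
rewrite sumEFin lee_fin (eq_big_nat _ _ (F2 := fun=> 1)); last first.
  by move=> k /andP[_ kn]; rewrite sE kn.
rewrite big_const_nat subn0 iter_addr addr0 /n -natr1.
have : (Num.truncn s)%:R <= s by rewrite truncn_le; lra.
by rewrite -[1 *+ _]/(_%:R) -natr1; lra.
Qed.

Lemma parabolic_dist_root (w : O) (n : int) (s : R) :
  parabolic_dist (graph_point (S^~ w) n) 0 <= s -> `|n|%N%:R <= s ^+ 2.
Proof.
rewrite /parabolic_dist ge_max /= subr0 => /andP[ns _].
have -> : `|n|%N%:R = `|n%:~R| :> R by rewrite natr_absz intr_norm.
by rewrite -(@sqr_sqrtr _ `|n%:~R|)// lerXn2r// nnegrE ?sqrtr_ge0// (le_trans _ ns) ?sqrtr_ge0.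
Qed.

(** Mass transport with the indicator of a selected point as [f]: the mark [true] lies in [B k] for
    k <= r^2, that is for at most 2 r^2 values of k, so c = 2 r^2. *)
Lemma lambda_ge (r : R) : 1 <= r ->
  (((4 * r ^+ 2)^-1)%:E <= lambda P Psi (@parabolic_dist R) r)%E.
Proof.
move=> r1; have r2 : 1 <= r ^+ 2 by nra.
apply: le_ereal_inf_tmp => _ [Z [eqZ cov] <-].
pose B (k : nat) : set bool := if k%:R <= r ^+ 2 then [set true] else set0.
have c0 : 0 < 2 * r ^+ 2 by lra.
have /= := @mass_transport _ _ _ _ _ P S hS Z eqZ B (fun u => (u%:R)%:E) _ c0 _ _ _ _ _.
have -> : (\int[P]_w \int[Z (Psi w)]_z ((mark z 0%R)%:R)%:E)%E = intensity P Psi Z.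
  apply: eq_integral => w _; pose A : set (g_sigma_algebraType (@cylinders _ _ bool (Psi w))) :=
    [set z : marking bool (Psi w) | marked_subset z 0].
  have P0 := walk_graph0 hS w.
  have mA : measurable A.
    rewrite (_ : A = [set z : marking bool (Psi w) | [set true] (mark z 0)]).
      exact: measurable_mark.
    by apply/seteqP; split=> z; [case|move=> z0; split].
  rewrite -[RHS]/(Z (Psi w) A) -[A]setIT -integral_indic//.
  apply: eq_integral => z _; rewrite indicE.
  have -> // : (z \in A) = mark z 0 by apply/idP/idP; rewrite inE; [case|split].
rewrite (_ : 2 * (2 * r ^+ 2) = 4 * r ^+ 2); last by ring.
move=> H; rewrite -[leLHS]mule1 lee_pdivrMl; last by lra.
apply: H.
- by move=> u; rewrite lee_fin.
- by [].
- by [].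
- move=> u; rewrite -EFinM; case: u => /=.
    rewrite mulr1 (eq_eseriesr (g := fun k : nat => ((k%:R <= r ^+ 2)%R%:R)%:E)).
      exact: nneseries_indic_le.
    move=> k _; rewrite indicE /B; case: ifP => _; last by rewrite in_set0.
    by rewrite mem_set.
  rewrite mulr0 eseries0// => k _ _; rewrite indicE /B.
  by case: ifP => _; rewrite memNset.
- apply: filterS cov => w; apply: negligibleS; apply: subsetC => z /(_ 0 (walk_graph0 hS w)) [v [[n _ <-] vt]].
  rewrite /cball; case: ifP => // _ [_ /parabolic_dist_root nr].
  by exists n; rewrite /B nr.
Qed.

(** Mass transport with the power [al] of the radius as [f]: a radius s >= 1 belongs to at most 2
    s^2 <= 2 s^al of the sets [B k], so c = 2. *)
Lemma hcontent1_ge (al : R) : 2 <= al ->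
  ((4^-1)%:E <= hcontent1 P Psi (@parabolic_dist R) al)%E.
Proof.
move=> al2; apply: le_ereal_inf_tmp => _ [Z [eqZ cov] <-].
(* Radius 0 is removed by hand: its ball is empty, although it satisfies the inequality at k = 0. *)
pose B (k : nat) : set (radiusM R) :=
  @radius_val R @^-1` ([set s | k%:R <= s ^+ 2] `&` [set~ 0]).
have /= := @mass_transport _ _ _ _ _ P S hS Z eqZ B
  (fun u => (pow0 (radius_val u) al)%:E) 2 _ _ _ _ _ _.
rewrite (_ : 2 * 2 = 4); last by ring.
move=> H; rewrite -[leLHS]mule1 lee_pdivrMl//; apply: H => //.
- by move=> u; rewrite lee_fin pow0_ge0.
- move=> k; rewrite -[B k]setTI; apply: measurable_radius_val => //.
  apply: measurableI; last exact: measurableC.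
  rewrite -[X in measurable X]setTI; apply: measurable_fun_ler => //.
- exact/measurable_EFinP/measurable_pow0.
- move=> u; have := valP u; rewrite -/(radius_val u) => /orP[/eqP u0|u1].
    rewrite eseries0; first by rewrite mule_ge0// lee_fin pow0_ge0.
    by move=> k _ _; rewrite indicE memNset// => -[_]; apply.
  have u0 : radius_val u != 0 by apply/eqP; lra.
  apply: (@le_trans _ _ (2 * radius_val u ^+ 2)%:E).
    rewrite (eq_eseriesr (g := fun k : nat => ((k%:R <= radius_val u ^+ 2)%R%:R)%:E)).
      by apply: nneseries_indic_le; nra.
    move=> k _; rewrite indicE.
    have -> // : (u \in B k) = (k%:R <= radius_val u ^+ 2).
    apply/idP/idP; rewrite inE; first by case.
    by move=> ku; split=> //; exact/eqP.
  rewrite -EFinM lee_fin ler_wpM2l// /pow0 (negbTE u0).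
  by rewrite -powR_mulrn ?ler_powR//; lra.
- apply: filterS cov => w; apply: negligibleS; apply: subsetC => z /(_ 0 (walk_graph0 hS w)) [_ [n _ <-]].
  rewrite /cball; case: ifP => // /negbT r0 [_ /parabolic_dist_root nr].
  by exists n; split=> //; exact/eqP.
Qed.

End Asymptotics.

(** * Asymptotics *)

Section UpperBounds.
Context {R : realType} {dO : measure_display} {O : measurableType dO}.
Context (P : probability O R) (S : int -> O -> int).
Hypothesis hS : simple_random_walk P S.
Local Notation Psi := (@walk_graph R dO O S).

(** Bound for the intensity at radius e^u: u^2 e^(-2u) bounds the inverse block length, and 2 e^(8 -
    2u) the tail of the walk within a block. *)
Definition cover_rate (u : R) : R := (u ^+ 2 + 2 * expR 8) * expR (- (2 * u)).

(** The polynomial factor is absorbed by an arbitrarily small loss in the exponent, since s u <=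
    e^(s u). *)
Lemma cover_rate_le (s u : R) : 0 < s -> 0 <= u ->
  cover_rate u <= (s ^- 2 + 2 * expR 8) * expR ((2 * s - 2) * u).
Proof.
move=> s0 u0; rewrite /cover_rate.
have -> : expR ((2 * s - 2) * u) = expR (s * u) ^+ 2 * expR (- (2 * u)).
  by rewrite expr2 -!expRD; congr expR; ring.
rewrite mulrA ler_wpM2r ?expR_ge0//.
have e1 := expR_ge1Dx (s * u); have su : 0 <= s * u by nra.
set E := expR (s * u) in e1 *.
have E1 : 1 <= E ^+ 2 by nra.
have u2 : u ^+ 2 <= s ^- 2 * E ^+ 2.
  rewrite mulrC ler_pdivlMr ?exprn_gt0//.
  by rewrite -exprMn mulrC lerXn2r// ?nnegrE; nra.
have : 0 < expR 8 :> R by exact: expR_gt0.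
by rewrite mulrDl; set C := expR 8; nra.
Qed.

(* Blocks of length about [r ^+ 2 / u ^+ 2] with [r = expR u], and the exponential
   moment at [x = 2 * u / r]. *)
Lemma cover_rate_bounds (u : R) : 12 <= u ->
  exists m tau, [/\ 1 <= expR u, m%:R <= expR u ^+ 2,
    (forall j : nat, (j <= m)%N ->
      (P [set w | (expR u < `|S j%:Z w|%:~R)%R] <= tau%:E)%E) &
    m.+1%:R^-1 + tau <= cover_rate u].
Proof.
move=> u12; set r := expR u.
have r0 : 0 < r by exact: expR_gt0.
(* From e^(u/2) >= 1 + u/2 and u^2/4 >= 3u, which is where 12 comes from. It yields x^2 <= 4/9,
   within the range of the tail bound. *)
have ur : 3 * u <= r.
  have -> : r = expR (u / 2) ^+ 2 by rewrite expr2 -expRD; congr expR; lra.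
  by have := expR_ge1Dx (u / 2); set y := expR _; nra.
have rV : expR (- (2 * u)) = r ^- 2.
  by rewrite expRN expr2 -expRD; congr (expR _)^-1; ring.
have u2 : 0 < u ^+ 2 by nra.
have q0 : 0 <= r ^+ 2 / u ^+ 2 by rewrite divr_ge0// ltW// exprn_gt0.
pose m := Num.truncn (r ^+ 2 / u ^+ 2).
have mq : m%:R <= r ^+ 2 / u ^+ 2 by rewrite truncn_le.
(* In the tail bound x r = 2u, and 2 x^2 j is at most 8 for j <= r^2 / u^2. *)
exists m, (2 * expR (8 - 2 * u)); split.
- by rewrite /r -expR0 ler_expR; lra.
- apply: (le_trans mq); rewrite ler_pdivrMr// ler_peMr ?ltW ?exprn_gt0//; nra.
- move=> j jm; pose x := 2 * u / r.
  have x0 : 0 <= x by rewrite divr_ge0 ?(ltW r0)//; lra.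
  have x2 : x ^+ 2 = 4 * u ^+ 2 / r ^+ 2 by rewrite /x; field; rewrite gt_eqF.
  have x2le : x ^+ 2 <= 2^-1.
    rewrite x2 ler_pdivrMr ?exprn_gt0//.
    have : (3 * u) ^+ 2 <= r ^+ 2 by rewrite lerXn2r ?nnegrE//; lra.
    by nra.
  apply: (le_trans (walk_tail hS r j x0 x2le)); rewrite lee_fin ler_wpM2l// ler_expR.
  have -> : x * r = 2 * u by rewrite /x; field; rewrite gt_eqF.
  rewrite lerB// -[_ *+ j]mulr_natr.
  apply: (@le_trans _ _ (2 * x ^+ 2 * (r ^+ 2 / u ^+ 2))).
    apply: ler_wpM2l; first by apply: mulr_ge0 => //; exact: sqr_ge0.
    by rewrite (le_trans _ mq)// ler_nat.
  rewrite x2 le_eqVlt; apply/orP; left; apply/eqP; field.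
  by rewrite !gt_eqF//; lra.
- rewrite /cover_rate [leRHS]mulrDl expRD rV mulrA lerD2r.
  rewrite -[leRHS]invrK invf_div.
  have qm : r ^+ 2 / u ^+ 2 < m.+1%:R by exact: truncnS_gt.
  have q1 : 0 < r ^+ 2 / u ^+ 2 by apply: divr_gt0 => //; exact: exprn_gt0.
  by rewrite lef_pV2 ?posrE ?ltr0n// ltW.
Qed.

Lemma lambda_expR_le (u : R) : 12 <= u ->
  (lambda P Psi (@parabolic_dist R) (expR u) <= (cover_rate u)%:E)%E.
Proof.
move=> /cover_rate_bounds[m [tau [r1 mr tail bnd]]].
by apply: (le_trans (lambda_le hS r1 mr tail)); rewrite lee_fin.
Qed.

Lemma hcontent1_expR_le (al u : R) : 12 <= u ->
  (hcontent1 P Psi (@parabolic_dist R) al <= (expR (al * u) * cover_rate u)%:E)%E.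
Proof.
move=> /cover_rate_bounds[m [tau [r1 mr tail bnd]]].
apply: (le_trans (hcontent1_le hS r1 mr tail al)).
by rewrite lee_fin /powR gt_eqF ?expR_gt0// expRK ler_wpM2l ?expR_ge0.
Qed.

Lemma hcontent1_eq0 (al : R) : al < 2 ->
  hcontent1 P Psi (@parabolic_dist R) al = 0%E.
Proof.
move=> al2; apply/eqP; rewrite eq_le; apply/andP; split; last first.
  apply: le_ereal_inf_tmp => _ [Z _ <-].
  by do 2![apply: integral_ge0 => ? _]; rewrite lee_fin pow0_ge0.
apply/lee_addgt0Pr => e e0; rewrite add0e.
(* This [s] makes the total exponent al + 2s - 2 equal to -2s, hence negative. *)
pose s := (2 - al) / 4; have s0 : 0 < s by rewrite /s; lra.
pose K := s ^- 2 + 2 * expR 8.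
have K0 : 0 < K by rewrite addr_gt0 ?mulr_gt0 ?expR_gt0 ?invr_gt0 ?exprn_gt0.
(* Large enough for K <= 2 s u e, which suffices because e^(2su) >= 2su. *)
pose u := 12 + K / (2 * s * e).
have se0 : 0 < 2 * s * e by apply: mulr_gt0 => //; exact: mulr_gt0.
have q0 : 0 <= K / (2 * s * e) by apply: divr_ge0; exact: ltW.
have u12 : 12 <= u by rewrite /u; lra.
apply: (le_trans (hcontent1_expR_le al u12)); rewrite lee_fin.
have u0 : 0 <= u by lra.
apply: (@le_trans _ _ (expR (al * u) * (K * expR ((2 * s - 2) * u)))).
  by rewrite ler_wpM2l ?expR_ge0//; exact: cover_rate_le.
rewrite mulrCA -expRD (_ : al * u + _ = - (2 * s * u)); last by rewrite /s; field.
rewrite expRN ler_pdivrMr ?expR_gt0//.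
have := expR_ge1Dx (2 * s * u).
suff : K <= e * (2 * s * u) by nra.
rewrite (_ : e * (2 * s * u) = u * (2 * s * e)); last by ring.
by rewrite -ler_pdivrMr// /u lerDr.
Qed.

Lemma walk_udimH : udimH P Psi (@parabolic_dist R) = 2%:E.
Proof.
apply/eqP; rewrite eq_le; apply/andP; split.
  apply: ge_ereal_sup => _ [->|[al [al0 h0] <-]]; first by rewrite lee_fin.
  rewrite lee_fin leNgt; apply/negP => al2.
  by have := hcontent1_ge hS (ltW al2); rewrite h0 lee_fin; lra.
apply/lee_subgt0Pr => e e0; rewrite -EFinB.
have [e2|e2] := leP e 2; last first.
  apply: (@le_trans _ _ 0%E); first by rewrite lee_fin; lra.
  by apply: ereal_sup_ubound; left.
apply: ereal_sup_ubound; right; exists (2 - e) => //.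
by split; [lra|apply: hcontent1_eq0; lra].
Qed.

(** With u = ln r >= 12 the bounds on lambda read (2 - 2s) u - ln K <= - ln lambda <= 2u + ln 4.
    Dividing by u leaves 2 in the limit, as s > 0 is arbitrary. *)
Lemma walk_udimM : is_udimM P Psi (@parabolic_dist R) 2%:E.
Proof.
pose l (r : R) := lambda P Psi (@parabolic_dist R) r.
have bounds r : expR 12 <= r -> exists v, [/\ l r = v%:E, 0 < v,
    (4 * r ^+ 2)^-1 <= v & v <= cover_rate (ln r)].
  move=> r12; have r0 : 0 < r by apply: lt_le_trans r12; exact: expR_gt0.
  have lnr : expR (ln r) = r by rewrite lnK.
  have u12 : 12 <= ln r by rewrite -ler_expR lnr.
  have r1 : 1 <= r by rewrite -lnr -expR0 ler_expR; lra.
  have lo : (((4 * r ^+ 2)^-1)%:E <= l r)%E := lambda_ge hS r1.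
  have hi := lambda_expR_le u12; rewrite lnr -/(l r) in hi.
  have lfin : l r \is a fin_num.
    by rewrite fin_numElt (lt_le_trans _ lo) ?ltNyr// (le_lt_trans hi) ?ltry.
  exists (fine (l r)); rewrite fineK//; split=> //.
  - rewrite -lte_fin fineK// (lt_le_trans _ lo)// lte_fin invr_gt0 mulr_gt0 ?exprn_gt0//.
  - by rewrite -lee_fin fineK.
  - by rewrite -lee_fin fineK.
have expE r v : expR 12 <= r -> l r = v%:E -> 0 < v ->
    (- lne (lambda P Psi (@parabolic_dist R) r) / (ln r)%:E)%E = (- ln v / ln r)%:E.
  move=> r12 lv v0; have r0 : 0 < r by apply: lt_le_trans r12; exact: expR_gt0.
  have lnr : 0 < ln r by apply: lt_le_trans (_ : 12 <= _) => //; rewrite -ler_expR lnK.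
  by rewrite -/(l r) lv lne_EFin// inver gt_eqF// -EFinN -EFinM.
apply/fine_cvgP; split.
  near=> r; have r12 : expR 12 <= r by near: r; exact: nbhs_pinfty_ge.
  by have [v [lv v0 _ _]] := bounds r r12; rewrite (expE r v).
(* The error 2su is half of eu. Beyond e^M the constant ln K fits into the other half, and ln 4 into
   eu. *)
apply/cvgrPdist_le => e e0; pose s := e / 4; have s0 : 0 < s by rewrite /s; lra.
pose K := s ^- 2 + 2 * expR 8.
have K0 : 0 < K by rewrite addr_gt0 ?mulr_gt0 ?expR_gt0 ?invr_gt0 ?exprn_gt0.
pose M : R := 12 + (`|ln 4| + 2 * `|ln K|) / e.
near=> r; have rM : expR M <= r by near: r; exact: nbhs_pinfty_ge.
have r0 : 0 < r by apply: lt_le_trans rM; exact: expR_gt0.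
have uM : M <= ln r by rewrite -ler_expR lnK.
have q0 : 0 <= (`|ln 4| + 2 * `|ln K|) / e.
  by rewrite divr_ge0 ?addr_ge0 ?mulr_ge0// ltW.
have u12 : 12 <= ln r by apply: le_trans uM; rewrite /M; lra.
have r12 : expR 12 <= r by rewrite -[leRHS]lnK// ler_expR.
have [v [lv v0 lo hi]] := bounds r r12.
rewrite /= (expE r v)//= ; set u := ln r in u12 uM hi *.
have u0 : 0 < u by lra.
have ue : `|ln 4| + 2 * `|ln K| <= u * e.
  by rewrite -ler_pdivrMr//; apply: le_trans uM; rewrite /M; lra.
have l4 : ln 4 <= `|ln 4| :> R by exact: ler_norm.
have lK : ln K <= `|ln K| by exact: ler_norm.
have lo' : - ln v <= ln 4 + 2 * u.
  rewrite -lnV ?posrE// (_ : 2 * u = ln (r ^+ 2)); last by rewrite lnXn// mulr_natl.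
  rewrite -lnM ?posrE ?exprn_gt0// ler_ln ?posrE ?invr_gt0 ?mulr_gt0 ?exprn_gt0//.
  by rewrite -[leRHS]invrK lef_pV2 ?posrE ?invr_gt0 ?mulr_gt0 ?exprn_gt0.
have hi' : ln v <= ln K + (2 * s - 2) * u.
  apply: (@le_trans _ _ (ln (K * expR ((2 * s - 2) * u)))).
    rewrite ler_ln ?posrE ?mulr_gt0 ?expR_gt0//.
    by apply: (le_trans hi); apply: cover_rate_le; rewrite ?ltW.
  by rewrite lnM ?posrE ?expR_gt0// expRK.
have -> : 2 - - ln v / u = (2 * u + ln v) / u by field; rewrite gt_eqF.
rewrite normrM normfV (gtr0_norm u0) ler_pdivrMr// ler_norml.
rewrite /s in hi'; have := normr_ge0 (ln K); have := normr_ge0 (ln 4 : R).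
by move=> ? ?; apply/andP; split; lra.
Unshelve. all: by end_near.
Qed.

End UpperBounds.

Theorem proposition6p10 (R : realType) (dO : measure_display)
    (O : measurableType dO) (P : probability O R) (S : int -> O -> int)
    (hS : simple_random_walk P S) :
  is_udimM P (walk_graph S) parabolic_dist 2%:E /\
  udimH P (walk_graph S) parabolic_dist = 2%:E.
Proof. by split; [exact: walk_udimM|exact: walk_udimH]. Qed.
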